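(* Let $(X,\|\cdot\|)$ be a separable real Banach space and let $\varphi\colon\mathcal{P}_X\to\mathcal{P}_X$ be a surjective $\pi$-isometry, i.e. a surjective map with $\pi(\varphi(\mu),\varphi(\nu))=\pi(\mu,\nu)$ for all $\mu,\nu\in\mathcal{P}_X$. Then there exists a surjective affine isometry $\psi\colon X\to X$ which induces $\varphi$, i.e. $$(\varphi(\mu))(A)=\mu(\psi^{-1}[A])\qquad(\forall\,\mu\in\mathcal{P}_X,\ \forall\,A\in\mathscr{B}_X),$$ where $\psi^{-1}[A]=\{\psi^{-1}(a)\mid a\in A\}$ is the inverse image of $A$ under $\psi$.
   Context: $\mathscr{B}_X$ is the Borel $\sigma$-algebra of $X$ (with respect to the norm metric $d(x,y)=\|x-y\|$) and $\mathcal{P}_X$ is the set of all Borel probability measures on $X$. The Lévy–Prokhorov distance on $\mathcal{P}_X$ is $$\pi(\mu,\nu):=\inf\{\varepsilon>0\mid \forall A\in\mathscr{B}_X:\ \mu(A)\le\nu(A^{\varepsilon})+\varepsilon\},$$ where $A^{\varepsilon}:=\bigcup_{x\in A}B_\varepsilon(x)$ and $B_\varepsilon(x):=\{z\in X\mid d(x,z)<\varepsilon\}$. A map is affine if it is linear up to a translation. *)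

(* Defs.v *)
From HB Require Import structures.
From mathcomp Require Import all_boot all_order all_algebra.
From mathcomp Require Import all_classical all_reals all_analysis.

Set Implicit Arguments.
Unset Strict Implicit.
Unset Printing Implicit Defensive.

Import Order.TTheory GRing.Theory Num.Theory.
Import numFieldNormedType.Exports.

Local Open Scope classical_set_scope.
Local Open Scope ring_scope.

Definition separable (X : topologicalType) : Prop :=
  exists D : set X, countable D /\ dense D.

Notation borel_space X := (g_sigma_algebraType (@open X)).

Definition borel_probability {R : realType} (X : completeNormedModType R) :=
  probability (borel_space X) R.

(* An element of [probability T R] is a function on all of [set T], constrained
   to be a measure on measurable sets only. Two of them are the same Borel
   probability measure when they agree on the Borel sets; Leibniz equality
   would also compare their irrelevant values on non-measurable sets. *)
Definition same_measure {R : realType} (X : completeNormedModType R)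
    (mu nu : borel_probability X) : Prop :=
  forall A : set (borel_space X), measurable A -> mu A = nu A.

Definition thickening {R : realType} (X : completeNormedModType R)
    (A : set X) (e : R) : set X :=
  \bigcup_(x in A) ball x e.

(* The set below is bounded from below by 0 and contains 1, so the real [inf]
   is not its default value. *)
Definition levy_prokhorov {R : realType} (X : completeNormedModType R)
    (mu nu : borel_probability X) : R :=
  inf [set e : R | 0 < e /\
    forall A : set (borel_space X), measurable A ->
      (mu A <= nu (thickening (A : set X) e) + e%:E)%E].

(* Since [levy_prokhorov] only sees values on Borel sets and vanishes only
   between measures that agree there, such a [phi] is compatible with
   [same_measure], so it is exactly a representative of a surjective isometry
   of the space of Borel probability measures. *)
Definition surjective_lp_isometry {R : realType} (X : completeNormedModType R)
    (phi : borel_probability X -> borel_probability X) : Prop :=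
  (forall nu, exists mu, same_measure (phi mu) nu) /\
  (forall mu nu, levy_prokhorov (phi mu) (phi nu) = levy_prokhorov mu nu).

Definition affine_map {R : realType} (X : completeNormedModType R)
    (psi : X -> X) : Prop :=
  exists (L : {linear X -> X}) (b : X), forall x, psi x = L x + b.

Definition norm_isometry {R : realType} (X : completeNormedModType R)
    (psi : X -> X) : Prop :=
  forall x y, `|psi x - psi y| = `|x - y|.

(* Main.v *)
Require Import Defs.
From HB Require Import structures.
From mathcomp Require Import all_boot all_order all_algebra.
From mathcomp Require Import all_classical all_reals all_analysis.
From mathcomp Require Import lra.

Set Implicit Arguments.
Unset Strict Implicit.
Unset Printing Implicit Defensive.

Import Order.TTheory GRing.Theory Num.Theory.
Import numFieldNormedType.Exports.

Local Open Scope classical_set_scope.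
Local Open Scope ring_scope.

(* Two measures are at distance < 1 exactly when their supports contain points
   at distance < 1.  Hence the ball of radius 1 around mu is determined by the
   open 1-neighbourhood of supp mu, and the Dirac masses are the measures for
   which it is minimal: phi sends delta_x to delta_(psi x) for a bijection psi.
   Since pi(delta_x, delta_y) = min(1, |x - y|), psi is an isometry at small
   scale, hence everywhere, and it is affine by Mazur-Ulam.

   After composing with the push-forward by psi^-1 we may assume that phi fixes
   every Dirac mass.  Then an atom x_0 of mu that is at distance at least 2 from
   the rest of the support stays an isolated atom of phi mu, with the same mass.
   Let mu = sum_k w_k delta_(x_k), with x_0 far from x_1, ..., x_n.  Moving a mass
   eps from the other atoms to x_0 while translating x_1, ..., x_n by v,
   |v| <= eps, costs at most eps and leaves w_i at x_i + v; if the result nu is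
   known to be fixed, then comparing phi mu with nu on {x_0, x_i + v} shows that
   phi mu gives mass at least w_i to the closed ball of radius eps around x_i + v.
   When the x_k are 4 eps-separated these balls are disjoint, so they carry all
   of phi mu; varying v leaves only the points x_k, so phi mu = mu.  As
   translations preserve the separation, eps can stay bounded below (unless nu has
   only two atoms, a case settled by the isolation of atoms), and
   induction on the mass 1 - w_0 reaches every w_0 >= 0.  Finitely supported
   measures with an additional far point of mass 0 are dense, so phi = id. *)

(** * Real-valued probability measures *)

Section RealValuedProbability.
Context {d : measure_display} {T : measurableType d} {R : realType}.
Implicit Types (mu nu : probability T R) (A B : set T).

Definition pr mu A : R := fine (mu A).

Lemma prE mu A : measurable A -> mu A = (pr mu A)%:E.
Proof. by move=> mA; rewrite /pr fineK// fin_num_measure. Qed.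

Lemma pr_ge0 mu A : 0 <= pr mu A.
Proof. exact: fine_ge0. Qed.

Lemma pr_set0 mu : pr mu set0 = 0.
Proof. by rewrite /pr measure0. Qed.

Lemma pr_setT mu : pr mu setT = 1.
Proof. by rewrite /pr probability_setT. Qed.

Lemma le_pr mu A B : measurable A -> measurable B -> A `<=` B ->
  pr mu A <= pr mu B.
Proof.
by move=> mA mB AB; rewrite -lee_fin -!prE// le_measure// inE.
Qed.

Lemma pr_le1 mu A : measurable A -> pr mu A <= 1.
Proof. by move=> mA; rewrite -(pr_setT mu); exact: le_pr. Qed.

Lemma pr_setC mu A : measurable A -> pr mu (~` A) = 1 - pr mu A.
Proof.
move=> mA; apply: EFin_inj; rewrite -prE; last exact: measurableC.
by rewrite probability_setC// prE.
Qed.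

Lemma pr_setU_le mu A B : measurable A -> measurable B ->
  pr mu (A `|` B) <= pr mu A + pr mu B.
Proof.
move=> mA mB; rewrite -lee_fin EFinD -!prE//; last exact: measurableU.
exact: measureU2.
Qed.

Lemma pr_setU mu A B : measurable A -> measurable B -> A `&` B = set0 ->
  pr mu (A `|` B) = pr mu A + pr mu B.
Proof.
move=> mA mB AB; apply: EFin_inj; rewrite EFinD -!prE//; last exact: measurableU.
exact: measureU.
Qed.

Lemma le_pr_null mu A B N : measurable A -> measurable B -> measurable N ->
  pr mu N = 0 -> A `<=` B `|` N -> pr mu A <= pr mu B.
Proof.
move=> mA mB mN N0 AB.
apply: (le_trans (le_pr mu mA (measurableU _ _ mB mN) AB)).
by apply: (le_trans (pr_setU_le mu mB mN)); rewrite N0 addr0.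
Qed.

(** Finite additivity in the form needed twice below: for atoms, and for disjoint balls whose masses
    are only bounded from below. *)
Lemma sum_le_pr mu n (D : nat -> set T) (w : nat -> R) (I : pred nat) A :
  (forall k, (k < n)%N -> measurable (D k)) -> measurable A ->
  (forall i j, (i < n)%N -> (j < n)%N -> i != j -> D i `&` D j = set0) ->
  (forall k, (k < n)%N -> w k <= pr mu (D k)) ->
  (forall k, (k < n)%N -> I k -> D k `<=` A) ->
  \sum_(k < n | I k) w k <= pr mu A.
Proof.
elim: n A => [|n IH] A mD mA dD wD DA; first by rewrite big_ord0 pr_ge0.
have mDn : measurable (D n) by exact: mD.
have IH' B : measurable B -> (forall k, (k < n)%N -> I k -> D k `<=` B) ->
    \sum_(k < n | I k) w k <= pr mu B.
  move=> mB DB; apply: IH => //.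
  - by move=> k kn; apply: mD; exact: ltnW.
  - by move=> i j iN jN; apply: dD; exact: ltnW.
  - by move=> k kn; apply: wD; exact: ltnW.
rewrite big_mkcond big_ord_recr -big_mkcond/=.
case: ifPn => In; last first.
  by rewrite addr0; apply: IH' => // k kn; apply: DA; exact: ltnW.
have mAD : measurable (A `\` D n) by exact: measurableD.
have -> : A = (A `\` D n) `|` D n.
  by rewrite setUC setDUK//; exact: DA.
rewrite pr_setU//; last by rewrite setDKI.
apply: lerD; last exact: wD.
apply: IH' => // k kn Ik x Dkx; split; first by apply: (DA k) => //; exact: ltnW.
move=> Dnx; have : (D k `&` D n) x by [].
by rewrite dD ?neq_ltn ?kn// ltnW.
Qed.

(** Continuity from above; the error term tends to 0 and disappears in the limit. *)
Lemma pr_bigcap_ge mu (F : nat -> set T) a : (forall n, measurable (F n)) ->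
  (forall m n, (m <= n)%N -> F n `<=` F m) ->
  (forall n, a <= pr mu (F n) + n.+1%:R^-1) -> a <= pr mu (\bigcap_n F n).
Proof.
move=> mF dF aF.
have mI : measurable (\bigcap_n F n) by exact: bigcapT_measurable.
have cF : (mu \o F) @ \oo --> mu (\bigcap_n F n).
  apply: nonincreasing_cvg_mu => //.
  - by rewrite ltey_eq fin_num_measure.
  - by move=> m n mn; apply/subsetPset; exact: dF.
have cpr : (fun n => pr mu (F n)) @ \oo --> pr mu (\bigcap_n F n).
  by apply: fine_cvg; rewrite /pr -prE.
have c1 : (fun n => pr mu (F n) + n.+1%:R^-1) @ \oo --> pr mu (\bigcap_n F n).
  rewrite -[X in _ --> X]addr0; apply: cvgD => //.
  exact: cvg_harmonic.
rewrite -(cvg_lim _ c1)//; apply: limr_ge; first exact: cvgP c1.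
by apply: nearW => n; exact: aF.
Qed.

(** On complements the inequality is reversed, as both total masses are 1. *)
Lemma eq_pr_of_le mu nu :
  (forall A, measurable A -> pr mu A <= pr nu A) ->
  forall A, measurable A -> pr mu A = pr nu A.
Proof.
move=> h A mA; apply/eqP; rewrite eq_le h//=.
have := h _ (measurableC mA); rewrite !pr_setC//; lra.
Qed.

End RealValuedProbability.

(** * The Levy-Prokhorov distance *)

Section Borel.
Context {R : realType} {X : completeNormedModType R}.
Implicit Types (mu nu : borel_probability X) (A B : set X) (x y : X) (e : R).

Lemma open_borel A : open A -> measurable (A : set (borel_space X)).
Proof. by move=> oA; exact: sub_sigma_algebra. Qed.

Lemma closed_borel A : closed A -> measurable (A : set (borel_space X)).
Proof.
move=> cA; rewrite -[A]setCK; apply: measurableC; apply: open_borel.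
by rewrite openC.
Qed.

Lemma in_ball x e y : ball x e y = (`|y - x| < e) :> Prop.
Proof. by rewrite -ball_normE /ball_ /= distrC. Qed.

Lemma open_thickening A e : open (thickening A e).
Proof. by apply: bigcup_open => x _; exact: ball_open. Qed.

Lemma ball_borel x e : measurable (ball x e : set (borel_space X)).
Proof. by apply: open_borel; exact: ball_open. Qed.

Lemma thickening_borel A e : measurable (thickening A e : set (borel_space X)).
Proof. by apply: open_borel; exact: open_thickening. Qed.

Lemma closed_point x : closed [set x].
Proof.
by apply: accessible_closed_set1; exact/hausdorff_accessible/norm_hausdorff.
Qed.

Lemma set1_borel x : measurable ([set x] : set (borel_space X)).
Proof. by apply: closed_borel; exact: closed_point. Qed.

Lemma thickening_le A e e' : e <= e' -> thickening A e `<=` thickening A e'.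
Proof. by move=> ee' z [x Ax xz]; exists x => //; exact: le_ball xz. Qed.

Lemma thickeningD A e e' :
  thickening (thickening A e) e' `<=` thickening A (e + e').
Proof.
by move=> z [y [x Ax xy] yz]; exists x => //; exact: ball_triangle xy yz.
Qed.

Lemma sub_thickening A e : 0 < e -> A `<=` thickening A e.
Proof. by move=> e0 x Ax; exists x => //; exact: ballxx. Qed.

(** The condition under the infimum in [levy_prokhorov], in real numbers and without [0 < e]. *)
Definition dominated e mu nu :=
  forall A : set (borel_space X), measurable A ->
    pr mu A <= pr nu (thickening A e) + e.

Lemma dominatedP e mu nu : dominated e mu nu <->
  forall A : set (borel_space X), measurable A ->
    (mu A <= nu (thickening (A : set X) e) + e%:E)%E.
Proof.
split=> h A mA; have := h A mA; last first.
  by rewrite !prE// -?EFinD ?lee_fin//; exact: thickening_borel.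
by rewrite !prE// -?EFinD ?lee_fin//; exact: thickening_borel.
Qed.

Lemma dominated_le e e' mu nu : e <= e' -> dominated e mu nu ->
  dominated e' mu nu.
Proof.
move=> ee' h A mA; apply: (le_trans (h A mA)); apply: lerD => //.
apply: le_pr; [exact: thickening_borel|exact: thickening_borel|].
exact: thickening_le.
Qed.

(** The hypothesis is applied to the complement of [thickening A e], whose own [e]-thickening misses
    [A]. *)
Lemma dominated_sym e mu nu : dominated e mu nu -> dominated e nu mu.
Proof.
move=> h A mA.
have mA' : measurable (~` thickening A e : set (borel_space X)).
  by apply: measurableC; exact: thickening_borel.
have := h _ mA'; rewrite pr_setC; last exact: thickening_borel.
have : pr nu (thickening (~` thickening A e) e) <= pr nu (~` A).
  apply: le_pr; [exact: thickening_borel|exact: measurableC|].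
  by move=> z [x Hx xz] Az; apply: Hx; exists z => //; exact: ball_sym.
by rewrite pr_setC//; lra.
Qed.

Lemma dominated_trans e e' mu nu rho : dominated e mu nu ->
  dominated e' nu rho -> dominated (e + e') mu rho.
Proof.
move=> h h' A mA.
have := h A mA; have := h' _ (thickening_borel A e).
have := le_pr rho (thickening_borel _ _) (thickening_borel _ _)
  (@thickeningD A e e').
lra.
Qed.

Let LPset mu nu := [set e : R | 0 < e /\
    forall A : set (borel_space X), measurable A ->
      (mu A <= nu (thickening (A : set X) e) + e%:E)%E].

Let LPset1 mu nu : LPset mu nu 1.
Proof.
split => // ; apply/dominatedP => A mA.
by have := pr_le1 mu mA; have := pr_ge0 nu (thickening A 1); lra.
Qed.

Let LPset_inf mu nu : has_inf (LPset mu nu).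
Proof.
split; first by exists 1; exact: LPset1.
by exists 0 => e [/ltW].
Qed.

Lemma levy_prokhorov_le1 mu nu : levy_prokhorov mu nu <= 1.
Proof. by apply: ge_inf; [exact: (LPset_inf mu nu).2|exact: LPset1]. Qed.

Lemma levy_prokhorov_ge0 mu nu : 0 <= levy_prokhorov mu nu.
Proof. by apply: lb_le_inf; [exists 1; exact: LPset1|move=> e [/ltW]]. Qed.

Lemma levy_prokhorov_le mu nu e : 0 < e -> dominated e mu nu ->
  levy_prokhorov mu nu <= e.
Proof.
move=> e0 h; apply: ge_inf; first exact: (LPset_inf mu nu).2.
by split => //; exact/dominatedP.
Qed.

Lemma levy_prokhorov_lt mu nu e : levy_prokhorov mu nu < e ->
  exists2 e', 0 < e' < e & dominated e' mu nu.
Proof.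
move=> h; have [e' [e'0 he'] ee'] := inf_lt (LPset_inf mu nu).1 h.
by exists e'; [rewrite e'0|exact/dominatedP].
Qed.

Lemma levy_prokhorov_dominated mu nu e : levy_prokhorov mu nu < e ->
  dominated e mu nu.
Proof.
move=> /levy_prokhorov_lt[e' /andP[_ /ltW e'e]]; exact: dominated_le.
Qed.

(** Passing to the limit allows [a = 0], which [levy_prokhorov_le] excludes. *)
Lemma levy_prokhorov_le_of_lt mu nu a : 0 <= a ->
  (forall e, a < e -> dominated e mu nu) -> levy_prokhorov mu nu <= a.
Proof.
move=> a0 h; apply/ler_addgt0Pr => e e0; apply: levy_prokhorov_le; first lra.
by apply: h; lra.
Qed.

Lemma levy_prokhorov_sym mu nu : levy_prokhorov mu nu = levy_prokhorov nu mu.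
Proof.
wlog suff : mu nu / levy_prokhorov mu nu <= levy_prokhorov nu mu.
  by move=> h; apply/eqP; rewrite eq_le !h.
apply: levy_prokhorov_le_of_lt; first exact: levy_prokhorov_ge0.
by move=> e /levy_prokhorov_dominated/dominated_sym.
Qed.

Lemma levy_prokhorov_triangle mu nu rho :
  levy_prokhorov mu rho <= levy_prokhorov mu nu + levy_prokhorov nu rho.
Proof.
apply: levy_prokhorov_le_of_lt; first by rewrite addr_ge0 ?levy_prokhorov_ge0.
move=> e he; set a := levy_prokhorov mu nu in he *.
set b := levy_prokhorov nu rho in he *.
have -> : e = (a + (e - a - b) / 2) + (b + (e - a - b) / 2) by lra.
by apply: dominated_trans; apply: levy_prokhorov_dominated; lra.
Qed.

Lemma same_measureP mu nu : same_measure mu nu <->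
  forall A : set (borel_space X), measurable A -> pr mu A = pr nu A.
Proof.
by split=> h A mA; [rewrite /pr h|rewrite !prE// h].
Qed.

Lemma same_measure_levy_prokhorov mu mu' nu : same_measure mu mu' ->
  levy_prokhorov mu nu = levy_prokhorov mu' nu.
Proof.
move=> /same_measureP h.
have hh e : dominated e mu nu <-> dominated e mu' nu.
  by split=> hd A mA; have := hd A mA; rewrite h.
rewrite /levy_prokhorov; congr inf; apply/seteqP.
by split=> e [e0 /dominatedP/hh/dominatedP].
Qed.

Lemma closed_bigcap_thickening A : closed A ->
  \bigcap_n thickening A n.+1%:R^-1 = A.
Proof.
move=> cA; apply/seteqP; split => [x h|x Ax n _]; last first.
  by apply: sub_thickening => //; rewrite invr_gt0.
apply: cA => B /nbhs_ballP[e /= e0 eB].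
near \oo => n.
have [y Ay yx] := h n I.
exists y; split => //; apply: eB; apply: ball_sym; apply: le_ball yx.
apply: ltW; near: n; exact: near_infty_natSinv_lt (PosNum e0).
Unshelve. all: by end_near. Qed.

Lemma closed_thickening_ge mu A a : closed A ->
  (forall n, a <= pr mu (thickening A n.+1%:R^-1) + n.+1%:R^-1) ->
  a <= pr mu A.
Proof.
move=> cA h; rewrite -(closed_bigcap_thickening cA).
apply: pr_bigcap_ge => //.
  by move=> n; exact: thickening_borel.
move=> m n mn; apply: thickening_le.
by rewrite lef_pV2 ?posrE// ler_nat ltnS.
Qed.

(** Thickenings of a closed set shrink to it, so the measures agree on closed sets, a pi-system that
    generates the Borel sets. *)
Lemma levy_prokhorov_eq0 mu nu : levy_prokhorov mu nu = 0 ->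
  same_measure mu nu.
Proof.
move=> h0.
have hC C : closed C -> mu C = nu C.
  move=> cC; have mC := closed_borel cC; rewrite !prE//; congr EFin.
  wlog suff : mu nu h0 / pr mu C <= pr nu C.
    by move=> h; apply/eqP; rewrite eq_le !h// levy_prokhorov_sym.
  apply: closed_thickening_ge => // n.
  by apply: (levy_prokhorov_dominated _ mC); rewrite h0 invr_gt0.
move=> A mA.
have oE : measurable = <<s [set C : set X | closed C] >> :> set (set (borel_space X)).
  apply/seteqP; split.
    apply: smallest_sub.
      exact: (@sigma_algebra_measurable _
        (g_sigma_algebraType [set C : set X | closed C])).
    move=> U oU; rewrite -[U]setCK.
    apply: (@measurableC _ (g_sigma_algebraType [set C : set X | closed C])).
    by apply: sub_sigma_algebra; exact: open_closedC.
  apply: smallest_sub; first exact: sigma_algebra_measurable.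
  by move=> C /closed_borel.
apply: (@measure_unique _ R (borel_space X) [set C : set X | closed C]
  (fun=> setT) oE _ _ _ mu nu) => //.
- by move=> C D /= cC cD; exact: closedI.
- by apply/seteqP; split => // x _; exists 0%N.
- by move=> n; rewrite /= probability_setT ltry.
Qed.

End Borel.

(** * The Mazur-Ulam theorem *)

Section Isometries.
Context {R : realType} {V : normedModType R}.
Implicit Types (x y z a b u v : V) (f g : V -> V).

(** Used to show that a norm vanishes by bounding all its multiples. *)
Lemma ler_norm_pmulrn (r c : R) : (forall n : nat, r *+ n <= c) -> r <= 0.
Proof.
move=> h; rewrite leNgt; apply/negP => r0.
have := archi_boundP (normr_ge0 (c / r)); set n := Num.bound _.
move=> /(le_lt_trans (ler_norm _)); rewrite ltr_pdivrMr// => cn.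
by have := h n; rewrite -mulr_natl leNgt cn.
Qed.

Definition isometric f := forall x y, `|f x - f y| = `|x - y|.

(* Cut the segment from y to x into steps shorter than 1. *)
Lemma truncated_isometry_le f :
  (forall x y, Num.min 1 `|f x - f y| = Num.min 1 `|x - y|) ->
  forall x y, `|f x - f y| <= `|x - y|.
Proof.
move=> hf x y.
have := archi_boundP (normr_ge0 (x - y)); set n := Num.bound _.
move=> xyn; have n0 : (0 : R) < n%:R by apply: le_lt_trans xyn.
have n0' : n%:R != 0 :> R by rewrite gt_eqF.
pose s := n%:R^-1 *: (x - y).
have s1 : `|s| < 1.
  by rewrite normrZ normfV ger0_norm ?ltW// mulrC ltr_pdivrMr// mul1r.
have step z : `|f (z + s) - f z| <= `|s|.
  (* As [|s| < 1], the minimum cannot be the truncation value 1, so this distance is preserved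
     exactly. *)
  have := hf (z + s) z; rewrite addrAC subrr add0r (min_r (ltW s1)) minElt.
  by case: ifP => _ e; [move: s1; rewrite -e ltxx|rewrite e].
have steps k : `|f (y + s *+ k) - f y| <= `|s| *+ k.
  elim: k => [|k IH]; first by rewrite !mulr0n addr0 subrr normr0.
  rewrite !mulrSr addrA; apply: (le_trans (ler_distD (f (y + s *+ k)) _ _)).
  by rewrite [leRHS]addrC; apply: lerD.
have := steps n; rewrite -scaler_nat scalerA divff// scale1r [y + _]addrC subrK.
by rewrite -mulr_natl normrZ normfV (ger0_norm (ltW n0)) mulrA divff// mul1r.
Qed.

Lemma isometric_inj f : isometric f -> injective f.
Proof.
move=> hf x y fxy; apply/eqP; rewrite -subr_eq0 -normr_eq0 -hf fxy subrr.
by rewrite normr0.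
Qed.

Lemma isometric_continuous f : isometric f -> continuous f.
Proof.
move=> hf x; apply/cvgrPdist_lt => e e0; near=> y.
by rewrite hf; near: y; exact: cvgr_dist_lt.
Unshelve. all: by end_near. Qed.

Lemma isometric_comp f g : isometric f -> isometric g -> isometric (f \o g).
Proof. by move=> hf hg x y; rewrite /= hf hg. Qed.

Lemma isometric_cancel f g : isometric f -> cancel g f -> isometric g.
Proof. by move=> hf gK x y; rewrite -hf !gK. Qed.

Lemma isometric_reflection z : isometric (fun x => z - x).
Proof. by move=> x y; rewrite opprB addrC addrA subrK distrC. Qed.

(* Vaisala's argument: with h the reflection x |-> a + b - x, the map
   g |-> h g^-1 h g preserves the isometries fixing a and b and doubles the
   displacement of the midpoint, which is bounded by |a - b|. *)
Lemma isometry_fixing_fixes_midpoint g g' a b : isometric g ->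
  cancel g g' -> cancel g' g -> g a = a -> g b = b ->
  g (2^-1 *: (a + b)) = 2^-1 *: (a + b).
Proof.
set m := 2^-1 *: (a + b) => hg gK g'K ga gb.
have hm : a + b - m = m.
  apply/eqP; rewrite subr_eq -[X in _ == X + X]scale1r -scalerDl.
  by rewrite /m scalerA -(_ : 1 = (1 + 1) * 2^-1) ?scale1r//; lra.
(* The claim is about all such isometries at once, because the induction passes from [g] to another
   one. *)
suff h k : forall g g', isometric g -> cancel g g' -> cancel g' g ->
    g a = a -> g b = b -> `|g m - m| *+ (2 ^ k) <= `|m - a| *+ 2.
  apply/eqP; rewrite -subr_eq0 -normr_eq0 eq_le normr_ge0 andbT.
  apply: (@ler_norm_pmulrn _ (`|m - a| *+ 2)) => n.
  apply: le_trans (h n g g' hg gK g'K ga gb).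
  by rewrite ler_wpMn2l// ltnW// ltn_expl.
elim: k => {g g' hg gK g'K ga gb} [|k IH] g g' hg gK g'K ga gb.
  rewrite expn0 mulr1n mulr2n (le_trans (ler_distD a _ _))//.
  by rewrite -{1}ga hg [`|a - m|]distrC.
have hg' := isometric_cancel hg g'K.
have g'a : g' a = a by rewrite -{1}ga gK.
have g'b : g' b = b by rewrite -{1}gb gK.
pose h x := a + b - x.
have hK : cancel h h by move=> x; rewrite /h opprB addrC subrK.
have hh : isometric h by exact: isometric_reflection.
have ha : h a = b by rewrite /h addrC addrA addNr add0r.
have hb : h b = a by rewrite /h addrK.
have := IH (h \o g' \o h \o g) (g' \o h \o g \o h).
rewrite /= ga gb ha hb g'a g'b ha hb => /(_ _ _ _ erefl erefl).
rewrite expnS mulnC mulrnA.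
(* Since [h] and [g'] are isometric and fix [m]-related points ([h m = m], [m = g' (g m)]), this is
   the distance from [g m] to its reflection in [m]. *)
rewrite (_ : `|h (g' (h (g m))) - m| = `|g m - m| *+ 2); last first.
  rewrite -{2}hm -/(h m) hh -{2}(gK m) hg' /h.
  have -> : a + b = m + m by apply/eqP; rewrite -subr_eq hm.
  by rewrite -[X in `|X|]addrA addrACA -mulr2n normrMn distrC.
rewrite -!mulrnA mulnC; apply.
- exact: (isometric_comp (isometric_comp (isometric_comp hh hg') hh) hg).
- by move=> x /=; rewrite hK g'K hK gK.
- by move=> x /=; rewrite g'K hK gK hK.
Qed.

(** With [h] and [h'] the reflections exchanging [a] with [b] and [f a] with [f b], the isometry
    [h \o f' \o h' \o f] fixes [a] and [b], hence their midpoint. So [f] preserves midpoints, and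
    [f - f 0] is additive. *)
Theorem mazur_ulam f f' : isometric f -> cancel f f' -> cancel f' f ->
  exists (L : {linear V -> V}) (c : V), forall x, f x = L x + c.
Proof.
move=> hf fK f'K; have hf' := isometric_cancel hf f'K.
have half2 z : 2^-1 *: z + 2^-1 *: z = z :> V.
  by rewrite -scalerDl -[RHS]scale1r; congr (_ *: _); lra.
have mid a b : f (2^-1 *: (a + b)) = 2^-1 *: (f a + f b).
  set m := 2^-1 *: (a + b); set m' := 2^-1 *: _.
  pose h x := a + b - x; pose h' x := f a + f b - x.
  have hK : cancel h h by move=> x; rewrite /h opprB addrC subrK.
  have h'K : cancel h' h' by move=> x; rewrite /h' opprB addrC subrK.
  have hm : h m = m by apply/eqP; rewrite subr_eq -scalerDr scalerDr half2.
  have gm : (h \o f' \o h' \o f) m = m.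
    apply: (@isometry_fixing_fixes_midpoint _ (f' \o h' \o f \o h)).
    - have hh c : isometric (fun x => c - x) by exact: isometric_reflection.
      exact: (isometric_comp (isometric_comp (isometric_comp (hh _) hf') (hh _)) hf).
    - by move=> x /=; rewrite hK f'K h'K fK.
    - by move=> x /=; rewrite f'K h'K fK hK.
    - by rewrite /= /h' addrAC subrr add0r fK /h addrK.
    - by rewrite /= /h' addrK fK /h addrAC subrr add0r.
  have e1 : f' (h' (f m)) = m by apply: (can_inj hK); rewrite hm.
  have : h' (f m) = f m by rewrite -{2}e1 f'K.
  move=> /eqP; rewrite subr_eq => /eqP e.
  by rewrite /m' e scalerDr half2.
pose T x := f x - f 0.
have hT : isometric T by move=> x y; rewrite /T opprB addrA subrK hf.
have T0 : T 0 = 0 by rewrite /T subrr.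
have nT x : `|T x| = `|x| by rewrite -[T x]subr0 -T0 hT subr0.
have Thalf x : T (2^-1 *: x) = 2^-1 *: T x.
  rewrite /T -{1}[x]addr0 mid scalerDr scalerBr -{2}(half2 (f 0)).
  by rewrite opprD addrA addrK.
have TD : {morph T : x y / x + y}.
  move=> x y; apply: (@scalerI _ _ 2^-1); first by rewrite invr_eq0 pnatr_eq0.
  by rewrite -Thalf /T mid addrACA -opprD scalerBr [_ *: (f 0 + _)]scalerDr half2.
have TMn x n : T (x *+ n) = T x *+ n.
  by elim: n => [|n IH]; rewrite ?mulr0n ?T0// !mulrSr TD IH.
have TN x : T (- x) = - T x.
  by apply/eqP; rewrite -addr_eq0 -TD addNr T0.
(* Replacing [r *+ n] by its integer part costs at most [|x|] on either side, so [n] times the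
   defect is at most [2 |x|] for every [n]. *)
have TZ r x : T (r *: x) = r *: T x.
  wlog r0 : r / 0 <= r.
    move=> H; have [/H//|/ltW r0] := leP 0 r.
    have : T (- r *: x) = - r *: T x by apply: H; rewrite oppr_ge0.
    by rewrite !scaleNr TN => /oppr_inj.
  apply/eqP; rewrite -subr_eq0 -normr_eq0 eq_le normr_ge0 andbT.
  apply: (@ler_norm_pmulrn _ (`|x| *+ 2)) => n.
  pose m := Num.truncn (r *+ n).
  have : (m%:R <= r *+ n < m.+1%:R) by apply: truncn_itv; rewrite mulrn_wge0.
  move=> mr.
  have rm : `|r *+ n - m%:R| <= 1.
    by rewrite ler_norml; move: mr; rewrite -natr1; lra.
  rewrite -[leLHS]normrMn mulrnBl -TMn.
  have -> : T (r *: x *+ n) - r *: T x *+ n =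
      T ((r *+ n - m%:R) *: x) + (m%:R - r *+ n) *: T x.
    rewrite [in T (_ *: x)]scalerBl TD TN scaler_nat TMn scalerBl scaler_nat.
    by rewrite !scalerMnl !TMn addrA subrK -TMn scalerMnl.
  rewrite (le_trans (ler_normD _ _))// nT !normrZ nT mulr2n.
  by apply: lerD; rewrite ler_piMl// distrC.
have Tlin : linear T by move=> r x y; rewrite TD TZ.
pose L : {linear V -> V} :=
  HB.pack T (GRing.isLinear.Build R V V *:%R T Tlin).
exists L, (f 0) => x.
by rewrite /= /T subrK.
Qed.

End Isometries.

Lemma separable_dense_seq {R : realType} (X : normedModType R) : separable X ->
  exists u : nat -> X, forall x (e : R), 0 < e -> exists n, `|x - u n| < e.
Proof.
move=> [D [/countable_injP[f finj] dD]].
(* An index that [f] does not take on [D] gets the default point 0, which does not affect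
   density. *)
pose u n := xget 0 [set x | D x /\ f x = n]; exists u => x e e0.
have [y [xy Dy]] : ball x e `&` D !=set0.
  by apply: dD; [exists x; exact: ballxx|exact: ball_open].
exists (f y); rewrite (_ : u (f y) = y); first by rewrite -ball_normE in xy.
rewrite /u; case: xgetP => [z -> [Dz fz]|/(_ y)[]//].
by apply: finj; rewrite ?inE.
Qed.

(** * Supports and Dirac masses *)

Section Support.
Context {R : realType} {X : completeNormedModType R}.
Implicit Types (mu nu : borel_probability X) (A B : set X) (x y : X) (e : R).

Definition supp mu : set X := [set x | forall e, 0 < e -> 0 < pr mu (ball x e)].

Lemma notin_supp mu x : ~ supp mu x -> exists2 e, 0 < e & pr mu (ball x e) = 0.
Proof.
move=> /existsNP[e /not_implyP[e0 h]]; exists e => //.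
by apply/eqP; rewrite eq_le pr_ge0 andbT leNgt; exact/negP.
Qed.

Lemma ball_sub_ball x y (r e : R) : `|x - y| + r <= e -> ball y r `<=` ball x e.
Proof.
move=> h z; rewrite !in_ball => zy.
by have := ler_distD y z x; rewrite (distrC y x); lra.
Qed.

Lemma closed_supp mu : closed (supp mu).
Proof.
move=> x hx e e0; have e20 : 0 < e / 2 by lra.
have [y [sy xy]] := hx _ (nbhsx_ballx x _ e20).
apply: lt_le_trans (sy _ e20) _.
apply: le_pr; [exact: ball_borel|exact: ball_borel|].
by apply: ball_sub_ball; move: xy; rewrite in_ball distrC; lra.
Qed.

Lemma supp_borel mu : measurable (supp mu : set (borel_space X)).
Proof. by apply: closed_borel; exact: closed_supp. Qed.

Lemma supp_sub_closed mu A : closed A -> 1 <= pr mu A -> supp mu `<=` A.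
Proof.
move=> cA A1; rewrite -[A]setCK => x sx nAx.
have : nbhs x (~` A) by apply: open_nbhs_nbhs; split => //; rewrite openC.
move=> /nbhs_ballP[e e0 eA].
have mA := closed_borel cA.
have : pr mu (ball x e) <= pr mu (~` A).
  by apply: le_pr => //; [exact: ball_borel|exact: measurableC].
by have := sx _ e0; rewrite pr_setC//; lra.
Qed.

Hypothesis X_sep : separable X.

(** Every point off the support has a null ball around it; by separability, countably many null
    balls with centres in a dense sequence and radii [1/(n+1)] cover these points. *)
Lemma pr_suppC mu : pr mu (~` supp mu) = 0.
Proof.
have [u hu] := separable_dense_seq X_sep.
pose F i n : set (borel_space X) := if pr mu (ball (u i) n.+1%:R^-1) == 0
  then ball (u i) n.+1%:R^-1 else set0.
have F0 i n : mu.-negligible (F i n).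
  rewrite /F; case: ifPn => [/eqP h|_]; last exact: negligible_set0.
  apply/negligibleP; first exact: ball_borel.
  by have := prE mu (ball_borel (u i) n.+1%:R^-1); rewrite h.
have : mu.-negligible (\bigcup_i \bigcup_n F i n).
  by apply: negligible_bigcup => i; apply: negligible_bigcup => n.
have sF : ~` supp mu `<=` \bigcup_i \bigcup_n F i n.
  move=> x /notin_supp[e e0 xe].
  have e20 : 0 < e / 2 by lra.
  near \oo => n.
  have ne : n.+1%:R^-1 < e / 2.
    by near: n; exact: near_infty_natSinv_lt (PosNum e20).
  have n0 : 0 < n.+1%:R^-1 :> R by rewrite invr_gt0.
  have [i xi] := hu x _ n0.
  exists i => //; exists n => //.
  rewrite /F ifT; first by rewrite in_ball.
  rewrite eq_le pr_ge0 andbT -xe; apply: le_pr; [exact: ball_borel|exact: ball_borel|].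
  by apply: ball_sub_ball; move: ne xi; set r := n.+1%:R^-1; lra.
move=> /(@negligibleS _ (borel_space X) _ mu _ _ sF)/negligibleP h; rewrite /pr h//.
by apply: measurableC; exact: supp_borel.
Unshelve. all: by end_near. Qed.

Lemma pr_supp mu : pr mu (supp mu) = 1.
Proof.
by have := pr_suppC mu; rewrite pr_setC ?supp_borel//; [lra|exact: supp_borel].
Qed.

Lemma pr_eq0 mu A : measurable (A : set (borel_space X)) ->
  (forall x, supp mu x -> ~ A x) -> pr mu A = 0.
Proof.
move=> mA h; apply/eqP; rewrite eq_le pr_ge0 andbT -(pr_suppC mu).
apply: le_pr => //; first by apply: measurableC; exact: supp_borel.
by move=> x Ax sx; exact: h sx Ax.
Qed.

Lemma le_pr_supp mu A B : measurable (A : set (borel_space X)) ->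
  measurable (B : set (borel_space X)) ->
  (forall x, supp mu x -> A x -> B x) -> pr mu A <= pr mu B.
Proof.
move=> mA mB h; apply: (@le_pr_null _ (borel_space X) _ mu A B (~` supp mu)) => //.
- by apply: measurableC; exact: supp_borel.
- exact: pr_suppC.
- move=> x Ax; have [sx|sx] := pselect (supp mu x); [left; exact: h|by right].
Qed.

Lemma supp_nonempty mu : exists x, supp mu x.
Proof.
apply: contrapT => h; have := pr_supp mu.
rewrite (_ : supp mu = set0) ?pr_set0; first by move=> /eqP; rewrite eq_sym oner_eq0.
by apply/seteqP; split => // x sx; apply: h; exists x.
Qed.

(** Without such points, the thickening of [supp mu] by [e < 1] is [nu]-null. With them, a set of
    mass above [e] must meet a small ball around [x], so its thickening contains a small ball around
    [y]. *)
Lemma levy_prokhorov_lt1 mu nu : levy_prokhorov mu nu < 1 <->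
  exists x y, [/\ supp mu x, supp nu y & `|x - y| < 1].
Proof.
split=> [/levy_prokhorov_lt[e /andP[e0 e1] h]|[x [y [sx sy xy]]]].
  apply: contrapT => H.
  have := h _ (supp_borel mu); rewrite pr_supp.
  rewrite pr_eq0 ?add0r; [lra|exact: thickening_borel|].
  move=> y sy [x sx] xy; apply: H; exists x, y; split => //.
  by move: xy; rewrite in_ball distrC; lra.
(* One third of the gap: [|x - y| + 2 * r] is still below 1, with one [r] for each of the two
   balls. *)
pose r := (1 - `|x - y|) / 3.
have r0 : 0 < r by rewrite /r; lra.
set a := pr mu (ball x r); set b := pr nu (ball y r).
have a0 : 0 < a by exact: sx.
have b0 : 0 < b by exact: sy.
(* The bound [1 - a <= e] forces the intersection with [ball x r]; the bound [1 - b <= e] makes the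
   mass of [ball y r] sufficient. *)
pose e := Num.max (1 - Num.min a b) (`|x - y| + 2 * r).
have [e1 [e2 [e3 e4]]] :
    1 - a <= e /\ 1 - b <= e /\ `|x - y| + 2 * r <= e /\ e < 1.
  rewrite /e !le_max gt_max !lexx !orbT lerB ?ge_min ?lexx//.
  rewrite lerB ?ge_min ?lexx ?orbT//; split => //; split => //; split => //.
  by apply/andP; split; [rewrite ltrBlDr ltrDl lt_min a0 b0|rewrite /r; lra].
apply: le_lt_trans e4; apply: levy_prokhorov_le.
  by have := normr_ge0 (x - y); lra.
move=> A mA; have [Ae|Ae] := leP (pr mu A) e.
  by apply: (le_trans Ae); rewrite lerDr pr_ge0.
have [z [Az xz]] : A `&` ball x r !=set0.
  apply: contrapT => /set0P/negP/negPn/eqP h.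
  have := pr_setU mu mA (ball_borel x r) h.
  have := pr_le1 mu (measurableU _ _ mA (ball_borel x r)).
  by rewrite -/a; lra.
have : b <= pr nu (thickening A e).
  apply: le_pr; [exact: ball_borel|exact: thickening_borel|].
  move=> w yw; exists z => //; apply: (@ball_sub_ball z y r) => //.
  have := ler_distD x z y; move: xz; rewrite in_ball; lra.
by have := pr_le1 mu mA; lra.
Qed.

Definition delta x : borel_probability X := dirac (x : borel_space X).

Lemma pr_delta x A : pr (delta x) A = (x \in A)%:R.
Proof. by rewrite /pr /= /dirac indicE. Qed.

Lemma pr_delta1 x A : A x -> pr (delta x) A = 1.
Proof. by move=> Ax; rewrite pr_delta mem_set. Qed.

Lemma pr_delta0 x A : ~ A x -> pr (delta x) A = 0.
Proof. by move=> Ax; rewrite pr_delta memNset. Qed.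

Lemma supp_delta x : supp (delta x) = [set x].
Proof.
apply/seteqP; split; last first.
  by move=> _ -> e e0; rewrite pr_delta1//; exact: ballxx.
apply: supp_sub_closed; last by rewrite pr_delta1.
exact: closed_point.
Qed.

Lemma same_measure_delta mu x : supp mu `<=` [set x] -> same_measure mu (delta x).
Proof.
move=> h; apply/same_measureP; apply: eq_pr_of_le => A mA.
have [Ax|Ax] := pselect (A x); first by rewrite (pr_delta1 Ax) pr_le1.
rewrite (pr_eq0 mA) ?pr_ge0// => y sy; by rewrite (h _ sy).
Qed.

(** Sets missing [x] are null, and among the others the singleton has the smallest thickening. *)
Lemma dominated_delta e x mu : 0 <= e ->
  dominated e (delta x) mu <-> 1 <= pr mu (ball x e) + e.
Proof.
move=> e0; have tx : thickening [set x] e = ball x e.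
  by apply/seteqP; split => [y [_ ->]//|y xy]; exists x.
split=> [/(_ _ (set1_borel x))|h A mA]; first by rewrite pr_delta1// tx.
have [Ax|Ax] := pselect (A x); last first.
  by rewrite pr_delta0// addr_ge0// pr_ge0.
rewrite pr_delta1//; apply: (le_trans h); rewrite lerD2r.
apply: le_pr; [exact: ball_borel|exact: thickening_borel|].
by rewrite -tx => y [z ->]; exists x.
Qed.

Lemma levy_prokhorov_delta x y :
  levy_prokhorov (delta x) (delta y) = Num.min 1 `|x - y|.
Proof.
apply/eqP; rewrite eq_le; apply/andP; split.
  rewrite le_min levy_prokhorov_le1/=.
  apply: levy_prokhorov_le_of_lt => // e xye.
  apply/dominated_delta; first by apply: le_trans (ltW xye).
  rewrite pr_delta1; first by have := normr_ge0 (x - y); lra.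
  by rewrite in_ball distrC.
rewrite leNgt; apply/negP => /levy_prokhorov_lt[e /andP[e0]].
rewrite lt_min => /andP[e1 exy] /(dominated_delta _ _ (ltW e0)).
rewrite pr_delta0; first lra.
by rewrite in_ball distrC; lra.
Qed.

End Support.

(** * Finitely supported measures and closed balls *)

Section Atoms.
Context {R : realType} {X : completeNormedModType R}.
Hypothesis X_sep : separable X.
Implicit Types (mu nu : borel_probability X) (A B : set X) (p y z : X) (e : R).

Definition distinct n (x : nat -> X) :=
  forall i j, (i < n)%N -> (j < n)%N -> i != j -> x i <> x j.

Lemma sum_atoms_le n (x : nat -> X) mu A : distinct n x ->
  measurable (A : set (borel_space X)) ->
  \sum_(k < n | x k \in A) pr mu [set x k] <= pr mu A.
Proof.
move=> dx mA.
apply: (@sum_le_pr _ (borel_space X) _ mu n (fun k => [set x k])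
  (fun k => pr mu [set x k]) (fun k => x k \in A)) => //.
- by move=> k _; exact: set1_borel.
- move=> i j iN jN ij; apply/seteqP; split => // z [-> /= xij].
  exact: dx xij.
- by move=> k kn; rewrite inE => Ax _ ->.
Qed.

(** The lower bounds of [sum_atoms_le] for [A] and its complement add up to 1, so both are
    equalities. *)
Lemma sum_atomsE n (x : nat -> X) mu A : distinct n x ->
  \sum_(k < n) pr mu [set x k] = 1 -> measurable (A : set (borel_space X)) ->
  pr mu A = \sum_(k < n | x k \in A) pr mu [set x k].
Proof.
move=> dx s1 mA; apply/eqP; rewrite eq_le sum_atoms_le// andbT.
have mAC := measurableC mA.
have := sum_atoms_le mu dx mAC; rewrite pr_setC//.
move: s1; rewrite (bigID (fun k : 'I_n => x k \in A))/=.
rewrite [in X in _ -> X -> _](eq_bigl (fun k : 'I_n => x k \notin A)); first lra.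
by move=> k; rewrite in_setC.
Qed.

Lemma same_measure_atoms n (x : nat -> X) mu nu : distinct n x ->
  \sum_(k < n) pr mu [set x k] = 1 ->
  (forall k, (k < n)%N -> pr mu [set x k] <= pr nu [set x k]) ->
  same_measure nu mu.
Proof.
move=> dx s1 h; apply/same_measureP => A mA; apply/esym.
apply: eq_pr_of_le mA => {}A mA.
rewrite (sum_atomsE dx s1 mA); apply: le_trans (sum_atoms_le nu dx mA).
by apply: ler_sum => k _; exact: h.
Qed.

Lemma supp_atoms n (x : nat -> X) mu : \sum_(k < n) pr mu [set x k] = 1 -> distinct n x ->
  forall z, supp mu z -> exists2 k, (k < n)%N & z = x k.
Proof.
move=> s1 dx; pose A := \bigcup_(k < n) [set x k].
suff : supp mu `<=` A by move=> h z /h[k kn ->]; exists k.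
have cA : closed A.
  rewrite /A bigcup_mkord; apply: closed_bigsetU => k _.
  exact: closed_point.
apply: supp_sub_closed => //.
rewrite (sum_atomsE dx s1 (closed_borel cA)) -s1 [leLHS]big_mkcond [leRHS]big_mkcond/=.
apply: ler_sum => k _; rewrite ifT ?inE//; by exists k => /=.
Qed.

Lemma exists_atomic n (x : nat -> X) (w : nat -> R) : distinct n x ->
  (forall k, 0 <= w k) -> \sum_(k < n) w k = 1 ->
  exists mu, forall k, (k < n)%N -> pr mu [set x k] = w k.
Proof.
move=> dx w0 s1.
pose m (k : nat) : {measure set (borel_space X) -> \bar R} :=
  mscale (NngNum (w0 k)) (dirac (x k : borel_space X)).
pose mu : {measure set (borel_space X) -> \bar R} := msum m n.
have muE A : mu A = (\sum_(k < n) w k * (x k \in A)%:R)%:E.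
  rewrite /mu /msum /= -sumEFin; apply: eq_bigr => k _.
  by rewrite /m /= /mscale /= diracE EFinM.
have mu1 : mu setT = 1%E.
  rewrite muE; congr EFin; rewrite -[RHS]s1; apply: eq_bigr => k _.
  by rewrite mem_set// mulr1.
pose P : borel_probability X := HB.pack_for (borel_probability X)
  (Measure.sort mu) (Measure.class mu) (Measure_isProbability.Build _ _ _ mu mu1).
exists P => k kn; rewrite /pr /= muE /= (bigD1 (Ordinal kn))//=.
rewrite mem_set// mulr1 big1 ?addr0// => j jk.
rewrite memNset ?mulr0//= => h.
by apply: (dx _ _ kn (ltn_ord j)) => //; apply: contra jk => /eqP e; apply/eqP/val_inj.
Qed.

Lemma finite_separation n (x : nat -> X) : distinct n x -> exists2 d : R, 0 < d &
  forall i j, (i < n)%N -> (j < n)%N -> i != j -> d <= `|x i - x j|.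
Proof.
(* The diagonal gets the value 1 to keep the minimum positive. *)
move=> dx; pose F (p : 'I_n * 'I_n) : R :=
  if p.1 == p.2 then 1 else `|x p.1 - x p.2|.
exists (\big[Num.min/1]_p F p).
  apply/bigmin_gtP; split => // -[i j] _; rewrite /F/=; case: ifPn => // ij.
  rewrite normr_gt0 subr_eq0; apply/eqP; exact: dx.
move=> i j iN jN ij; apply: le_trans (bigmin_le _ (Ordinal iN, Ordinal jN) _) _.
by rewrite /F /= ifN.
Qed.

Definition cball p e : set X := [set z | `|z - p| <= e].

Lemma closed_cball p e : closed (cball p e).
Proof.
rewrite -[cball p e]setCK; apply: open_closedC; rewrite openE => z /=.
move=> /negP; rewrite -ltNge => ez; apply/nbhs_ballP.
exists (`|z - p| - e); first by rewrite /= subr_gt0.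
move=> u; rewrite in_ball => uz /=; apply/negP; rewrite -ltNge.
by have := ler_distD u z p; rewrite (distrC z u); lra.
Qed.

Lemma cball_borel p e : measurable (cball p e : set (borel_space X)).
Proof. by apply: closed_borel; exact: closed_cball. Qed.

Lemma cball_ge mu p e a :
  (forall e', e < e' -> a <= pr mu (ball p e') + (e' - e)) ->
  a <= pr mu (cball p e).
Proof.
move=> h; have n0 n : 0 < n.+1%:R^-1 :> R by rewrite invr_gt0.
have -> : cball p e = \bigcap_n ball p (e + n.+1%:R^-1).
  apply/seteqP; split => [z /= ze n _|z hz].
    by rewrite in_ball; apply: le_lt_trans ze _; rewrite ltrDl.
  rewrite /cball /= leNgt; apply/negP => ez.
  have ez0 : 0 < `|z - p| - e by rewrite subr_gt0.
  near \oo => n.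
  have ne : n.+1%:R^-1 < `|z - p| - e.
    by near: n; exact: near_infty_natSinv_lt (PosNum ez0).
  by have := hz n I; rewrite in_ball; move: ne; set r := n.+1%:R^-1; lra.
apply: (@pr_bigcap_ge _ (borel_space X)) => [n|m n mn|n].
- exact: ball_borel.
- apply: le_ball; rewrite lerD2l lef_pV2 ?posrE//.
  by rewrite ler_nat ltnS.
- have := h (e + n.+1%:R^-1); rewrite ltrDl n0 => /(_ isT).
  by rewrite addrAC subrr add0r.
Unshelve. all: by end_near. Qed.

End Atoms.

(** * Isometries fixing the Dirac masses *)

Section Rigidity.
Context {R : realType} {X : completeNormedModType R}.
Hypothesis X_sep : separable X.
Implicit Types (mu nu : borel_probability X) (A B : set X) (p y z : X) (e : R).

Lemma same_measure_sym mu nu : same_measure mu nu -> same_measure nu mu.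
Proof. by move=> h A mA; rewrite h. Qed.

Lemma same_measure_trans mu nu rho : same_measure mu nu ->
  same_measure nu rho -> same_measure mu rho.
Proof. by move=> h h' A mA; rewrite h// h'. Qed.

Lemma same_measure_levy_prokhorov0 mu nu : same_measure mu nu ->
  levy_prokhorov mu nu = 0.
Proof.
move=> h; rewrite (same_measure_levy_prokhorov _ h).
apply/eqP; rewrite eq_le levy_prokhorov_ge0 andbT.
apply: levy_prokhorov_le_of_lt => // e e0 A mA.
apply: ler_wpDr; first exact: ltW.
by apply: le_pr => //; [exact: thickening_borel|exact: sub_thickening].
Qed.

(** For [e < 1] the ball [ball y e] meets the support of [rho] in [y] at most, so [dominated_delta]
    only sees the mass of [y]. *)
Lemma levy_prokhorov_isolated rho y :
  (forall x, supp rho x -> `|x - y| < 1 -> x = y) ->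
  levy_prokhorov (delta y) rho = 1 - pr rho [set y].
Proof.
move=> iso; have m1 := set1_borel y; apply/eqP; rewrite eq_le; apply/andP; split.
  apply: levy_prokhorov_le_of_lt; first by rewrite subr_ge0 pr_le1.
  move=> e he; have e0 : 0 < e by have := pr_le1 rho m1; lra.
  apply/dominated_delta; first exact: ltW.
  suff : pr rho [set y] <= pr rho (ball y e) by lra.
  apply: le_pr => //; first exact: ball_borel.
  by move=> _ ->; exact: ballxx.
rewrite leNgt; apply/negP => /levy_prokhorov_lt[e /andP[e0 ey]].
move=> /(dominated_delta _ _ (ltW e0)) h.
suff : pr rho (ball y e) <= pr rho [set y] by lra.
apply: (le_pr_supp X_sep) => //; first exact: ball_borel.
move=> x sx; rewrite in_ball => xy; apply: iso => //.
by have := pr_ge0 rho [set y]; lra.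
Qed.

(** The point of the unit sphere around [y] in the direction of [x]. A Dirac mass at [p] detects [x]
    but not [y] at distance below 1. *)
Lemma exists_on_sphere x y : x != y -> `|x - y| < 2 ->
  exists2 p, `|p - x| < 1 & `|p - y| = 1.
Proof.
move=> xy xy2; have xy0 : 0 < `|x - y| by rewrite normr_gt0 subr_eq0.
exists (y + `|x - y|^-1 *: (x - y)); last first.
  by rewrite addrAC subrr add0r normrZ normfV normr_id mulVf// gt_eqF.
have -> : y + `|x - y|^-1 *: (x - y) - x = (`|x - y|^-1 - 1) *: (x - y).
  by rewrite scalerBl scale1r opprB [RHS]addrA addrAC addrC addrA.
rewrite normrZ -{2}[`|x - y|]ger0_norm// -normrM mulrBl mulVf ?gt_eqF// mul1r.
by rewrite ltr_norml; lra.
Qed.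

Variable phi : borel_probability X -> borel_probability X.
Hypothesis phi_iso : forall mu nu,
  levy_prokhorov (phi mu) (phi nu) = levy_prokhorov mu nu.

Lemma isometry_same mu nu : same_measure mu nu -> same_measure (phi mu) (phi nu).
Proof.
move=> h; apply: levy_prokhorov_eq0.
by rewrite phi_iso; exact: same_measure_levy_prokhorov0.
Qed.

Hypothesis phi_delta : forall x, same_measure (phi (delta x)) (delta x).

Lemma levy_prokhorov_delta_phi p mu :
  levy_prokhorov (delta p) (phi mu) = levy_prokhorov (delta p) mu.
Proof.
by rewrite -(phi_iso _ mu); apply/esym/same_measure_levy_prokhorov/phi_delta.
Qed.

(** A point [x != y] of [supp (phi mu)] within 2 of [y] would be detected from some [p] with
    [|p - y| = 1]. Then [p] also detects a point of [supp mu], which lies within 2 of [y] and so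
    equals [y]: a contradiction. The mass of [y] is read off from the distance to [delta y]. *)
Lemma isolated_atom mu y : (forall x, supp mu x -> `|x - y| < 2 -> x = y) ->
  (forall x, supp (phi mu) x -> `|x - y| < 2 -> x = y) /\
  pr (phi mu) [set y] = pr mu [set y].
Proof.
move=> iso.
have iso' x : supp (phi mu) x -> `|x - y| < 2 -> x = y.
  move=> sx xy2; apply/eqP; apply: contrapT => /negP xy.
  have [p px py] := exists_on_sphere xy xy2.
  have : levy_prokhorov (delta p) (phi mu) < 1.
    apply/(levy_prokhorov_lt1 X_sep); exists p, x; split => //.
    by rewrite supp_delta.
  rewrite levy_prokhorov_delta_phi => /(levy_prokhorov_lt1 X_sep)[q [z []]].
  rewrite supp_delta => -> sz pz.
  have zy : z = y.
    apply: iso => //; have := ler_distD p z y; rewrite (distrC z p); lra.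
  by move: pz; rewrite zy py ltxx.
split=> //; have h x : `|x - y| < 1 -> `|x - y| < 2 by lra.
have := levy_prokhorov_delta_phi y mu.
rewrite !levy_prokhorov_isolated; first lra.
- by move=> x sx /h; exact: iso.
- by move=> x sx /h; exact: iso'.
Qed.

Lemma isolated_of_atoms n (x : nat -> X) mu k :
  \sum_(i < n) pr mu [set x i] = 1 -> distinct n x ->
  (forall i, (i < n)%N -> i != k -> 2 <= `|x i - x k|) ->
  forall z, supp mu z -> `|z - x k| < 2 -> z = x k.
Proof.
move=> s1 dx far z /(supp_atoms s1 dx)[i iN ->].
have [->//|ik] := eqVneq i k.
by rewrite ltNge far.
Qed.

(** Both points are isolated at scale 2, so each keeps its mass; one of the masses may be 0. *)
Lemma two_atoms_fixed mu y z : pr mu [set y] + pr mu [set z] = 1 ->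
  2 <= `|y - z| -> same_measure (phi mu) mu.
Proof.
move=> s1 yz; pose x (k : nat) := if k is 0%N then y else z.
have yz' : y <> z by move=> e; move: yz; rewrite e subrr normr0; lra.
have dx : distinct 2 x.
  by move=> [|[|//]] [|[|//]]//= _ _ _ => // /esym.
have sx : \sum_(i < 2) pr mu [set x i] = 1.
  by rewrite !big_ord_recl big_ord0 addr0.
apply: (same_measure_atoms dx sx) => k k2.
suff /isolated_atom[_ ->//] : forall u, supp mu u -> `|u - x k| < 2 -> u = x k.
apply: (isolated_of_atoms sx dx).
by move: k k2 => [|[|//]] _ [|[|//]]//= _ _; rewrite distrC.
Qed.

(* The lower bound 3 - w_0 on the distance to [x 0] shrinks when mass is moved to
   [x 0]: this pays for the translation of the other atoms. *)
Definition spread c n (x : nat -> X) mu :=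
  [/\ \sum_(k < n.+1) pr mu [set x k] = 1,
      forall i j, (0 < i <= n)%N -> (0 < j <= n)%N -> i != j ->
        4 * c < `|x i - x j| &
      forall k, (0 < k <= n)%N -> 3 - pr mu [set x 0%N] <= `|x k - x 0%N| ].

Lemma far_base n (x : nat -> X) mu k :
  (forall k, (0 < k <= n)%N -> 3 - pr mu [set x 0%N] <= `|x k - x 0%N|) ->
  (0 < k <= n)%N -> 2 <= `|x k - x 0%N|.
Proof. by move=> h /h; have := pr_le1 mu (set1_borel (x 0%N)); lra. Qed.

Lemma spread_distinct c n (x : nat -> X) mu : 0 < c -> spread c n x mu ->
  distinct n.+1 x.
Proof.
move=> c0 [_ sep far] i j; rewrite !ltnS => iN jN ij xij.
wlog ij' : i j iN jN ij xij / (i < j)%N.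
  move=> h; move: (ij); rewrite neq_ltn => /orP[|] lij; first exact: (h i j).
  by apply: (h j i) => //; rewrite eq_sym.
have [i0|i0] := posnP i.
  have j0 : (0 < j <= n)%N by rewrite jN (leq_ltn_trans _ ij').
  by have := far_base far j0; rewrite -xij i0 subrr normr0; lra.
have := sep i j; rewrite i0 iN jN (ltn_trans i0 ij') => /(_ isT isT ij).
by rewrite xij subrr normr0; lra.
Qed.

Lemma sum_single n i (a : R) : (i < n)%N -> \sum_(k < n) (k == i :> nat)%:R * a = a.
Proof.
move=> iN; rewrite (bigD1 (Ordinal iN))//= eqxx mul1r big1 ?addr0// => k ki.
case: eqP => [e|]; last by rewrite mul0r.
by case/eqP: ki; exact: val_inj.
Qed.

Variables (c : R) (K : nat).
Hypotheses (c0 : 0 < c) (c2 : c < 2^-1).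
Hypothesis IH : forall n x mu, spread c n x mu ->
  1 - pr mu [set x 0%N] <= K%:R * c -> same_measure (phi mu) mu.

(** The mass moved to [x 0], also used as translation length and ball radius. The bound [c] keeps
    the balls disjoint; the other bound is the mass available outside [x 0] and [x i]. *)
Definition shift mu (x : nat -> X) i :=
  Num.min c (1 - pr mu [set x 0%N] - pr mu [set x i]).

(** * Induction step: from mass [K * c] outside the base atom to [(K + 1) * c] *)

Section Step.
Variables (n : nat) (x : nat -> X) (mu : borel_probability X).
Hypothesis sp : spread c n x mu.
Hypothesis Kc : 1 - pr mu [set x 0%N] <= K.+1%:R * c.
Let w k := pr mu [set x k].
Let dx := spread_distinct c0 sp.

Lemma base_atom : (forall z, supp mu z -> `|z - x 0%N| < 2 -> z = x 0%N) /\
  (forall z, supp (phi mu) z -> `|z - x 0%N| < 2 -> z = x 0%N) /\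
  pr (phi mu) [set x 0%N] = w 0%N.
Proof.
case: sp => s1 sep far.
have iso z : supp mu z -> `|z - x 0%N| < 2 -> z = x 0%N.
  apply: (isolated_of_atoms s1 dx) => i; rewrite ltnS -lt0n => iN i0.
  by apply: (far_base far); rewrite i0.
by split=> //; exact: isolated_atom.
Qed.

Lemma pair_le1 i : (0 < i <= n)%N -> w 0%N + w i <= 1.
Proof.
move=> /andP[i0 iN]; have m1 := set1_borel (x 0%N); have m2 := set1_borel (x i).
rewrite -(@pr_setU _ (borel_space X) _ mu [set x 0%N] [set x i])//.
  by apply: pr_le1; exact: measurableU.
apply/seteqP; split => // z [-> /= e]; move: e.
by apply: dx => //; rewrite eq_sym -lt0n.
Qed.

Lemma shift_ge0 i : (0 < i <= n)%N -> 0 <= shift mu x i.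
Proof. by move=> /pair_le1; rewrite /w /shift le_min (ltW c0)/=; lra. Qed.

Lemma shift_le i : shift mu x i <= c.
Proof. by rewrite /shift ge_min lexx. Qed.

(* The mass [shift mu x i] goes from the atoms other than [x 0] and [x i], whose
   weights are all multiplied by the same factor r, to [x 0]. If these atoms have
   total mass t = 0, then r = 0 / 0 = 0 and the formulas remain correct. *)
Lemma exists_test_measure i v : (0 < i <= n)%N -> `|v| <= shift mu x i ->
  exists nu, [/\ same_measure (phi nu) nu,
    pr nu [set x 0%N] = w 0%N + shift mu x i, pr nu [set x i + v] = w i &
    forall e, shift mu x i < e -> dominated e nu mu].
Proof.
move=> i0N; case/andP: (i0N) => i0 iN; set eps := shift mu x i => ve.
case: (sp) => s1 sep far.
have eps0 : 0 <= eps by exact: shift_ge0.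
have epsc : eps <= c by exact: shift_le.
pose t := 1 - w 0%N - w i; have t0 : 0 <= t by have := pair_le1 i0N; rewrite /t; lra.
have epst : eps <= t by rewrite /eps /shift ge_min lexx orbT.
pose r := (t - eps) / t.
have rt : r * t = t - eps.
  have [t00|tn0] := eqVneq t 0; last by rewrite /r divfK.
  by rewrite t00 mulr0; lra.
have r0 : 0 <= r by rewrite divr_ge0// subr_ge0.
have r1 : r <= 1.
  have [t00|tn0] := eqVneq t 0; first by rewrite /r t00 invr0 mulr0.
  by rewrite ler_pdivrMr ?mul1r ?gerBl// lt_neqAle eq_sym tn0.
have w0 k : 0 <= w k by exact: pr_ge0.
pose x' (k : nat) : X := if k == 0%N then x 0%N else x k + v.
(* The corrections undo the factor [r] at [0] and at [i], and add [eps] at [0]. *)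
pose w' (k : nat) : R := r * w k + (k == 0%N)%:R * (eps + (1 - r) * w 0%N) +
  (k == i)%:R * ((1 - r) * w i).
have w'0 : w' 0%N = w 0%N + eps.
  by rewrite /w' eqxx [_ == i]eq_sym gtn_eqF//= mul0r mul1r; lra.
have w'i : w' i = w i.
  by rewrite /w' eqxx gtn_eqF//= mul0r mul1r; lra.
have w'k k : (0 < k)%N -> w' k <= w k.
  move=> k0; have [->|ki] := eqVneq k i; first by rewrite w'i.
  by rewrite /w' gtn_eqF// (negbTE ki)/= !mul0r !addr0 ler_piMl.
have w'_ge0 k : 0 <= w' k.
  have r1' : 0 <= 1 - r by lra.
  by rewrite /w' !(r1', w0, r0, eps0, ler0n, mulr_ge0, addr_ge0).
have w's : \sum_(k < n.+1) w' k = 1.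
  rewrite /w' !big_split/= -mulr_sumr s1 !sum_single//.
  by move: rt; rewrite /t; lra.
have x'0 k : (0 < k)%N -> x' k = x k + v by move=> k0; rewrite /x' gtn_eqF.
have x'far k : (0 < k <= n)%N -> 3 - w' 0%N <= `|x' k - x' 0%N|.
  move=> /[dup] /far + /andP[k0 _]; rewrite x'0// /x' eqxx -/(w 0%N) w'0.
  have := ler_distD (x k + v) (x k) (x 0%N).
  by rewrite opprD addrA subrr add0r normrN; lra.
have x'sep k l : (0 < k <= n)%N -> (0 < l <= n)%N -> k != l ->
    4 * c < `|x' k - x' l|.
  move=> kN lN kl; case/andP: (kN) => k0 _; case/andP: (lN) => l0 _.
  by rewrite !x'0// opprD addrACA subrr addr0; exact: sep.
have w'01 : w' 0%N <= 1.
  by rewrite w'0; move: epst; rewrite /t; have := w0 i; lra.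
have dx' : distinct n.+1 x'.
  move=> k l; rewrite !ltnS => kN lN kl e.
  wlog kl' : k l kN lN kl e / (k < l)%N.
    move=> h; move: (kl); rewrite neq_ltn => /orP[|] lij; first exact: (h k l).
    by apply: (h l k) => //; rewrite eq_sym.
  have [k00|k0] := posnP k.
    have l0 : (0 < l <= n)%N by rewrite lN (leq_ltn_trans _ kl').
    by have := x'far l l0; rewrite -e k00 subrr normr0; lra.
  have := x'sep k l; rewrite k0 kN lN (ltn_trans k0 kl') => /(_ isT isT kl).
  by rewrite e subrr normr0; lra.
have [nu nuE] := exists_atomic dx' w'_ge0 w's.
have nu0 : pr nu [set x 0%N] = w 0%N + eps by rewrite -w'0 -nuE.
have nui : pr nu [set x i + v] = w i by rewrite -w'i -x'0// nuE.
have nu1 : \sum_(k < n.+1) pr nu [set x' k] = 1.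
  by rewrite -w's; apply: eq_bigr => k _; rewrite nuE.
exists nu; split => //.
(* If [eps = c], the mass outside the base atom drops by [c] and [IH] applies; if [eps = t], only
   the two atoms at [x 0] and [x i + v] remain. *)
- have [e|e] : eps = c \/ eps = t.
    by rewrite /eps /shift minElt; case: ifP; [left|right].
    apply: (IH (n := n) (x := x')).
      split => // k kN; rewrite nuE//; exact: x'far.
    rewrite nuE// w'0 e; move: Kc; rewrite -natr1 mulrDl mul1r -/(w 0%N); lra.
  apply: (@two_atoms_fixed _ (x 0%N) (x i + v)).
    by rewrite nu0 nui e /t; lra.
  have := x'far i i0N; rewrite x'0// /x' eqxx distrC; lra.
(* Atoms other than [x 0] are displaced by at most [eps < e] and gain no weight; the base atom stays
   and gains [eps]. *)
- move=> e epse A mA.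
  rewrite (sum_atomsE dx' nu1 mA) (sum_atomsE dx s1 (thickening_borel A e)).
  apply: (@le_trans _ _ (\sum_(k < n.+1)
    ((if x k \in thickening A e then w k else 0) + (k == 0%N :> nat)%:R * eps))).
    rewrite [leLHS]big_mkcond/=; apply: ler_sum => k _.
    case: ifPn => [|_]; last by rewrite addr_ge0 ?mulr_ge0//; case: ifP.
    rewrite inE => Ax'; rewrite nuE// ifT; last first.
      rewrite inE; exists (x' k) => //; rewrite in_ball /x'; case: eqP => [->|_].
        by rewrite subrr normr0 (le_lt_trans _ epse).
      by rewrite opprD addrA subrr add0r normrN; lra.
    have [->|k0] := posnP k; first by rewrite w'0 mul1r.
    by rewrite mul0r addr0 w'k.
  by rewrite big_split/= sum_single// -big_mkcond/= lerD2l; lra.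
Qed.

(** The fixed test measure gives [x 0] and [x i + v] the mass [w 0 + eps + w i]. Near [x 0],
    [phi mu] has only the mass [w 0], and the error [eps] cancels the gain at [x 0], so [w i] must
    be found near [x i + v]. *)
Lemma pushed_atom i v : (0 < i <= n)%N -> `|v| <= shift mu x i ->
  w i <= pr (phi mu) (cball (x i + v) (shift mu x i)).
Proof.
move=> iN vi; have [nu [nuF nu0 nui nud]] := exists_test_measure iN vi.
set eps := shift mu x i in vi nu0 nud *.
case: base_atom => _ [iso' m0]; case: (sp) => _ _ far.
apply: cball_ge => e epse.
(* For [e > 2] the error [e - eps] already exceeds 1. *)
have [e2|e2] := leP e 2; last first.
  apply: (le_trans (pr_le1 mu (set1_borel (x i)))).
  apply: (@le_trans _ _ (e - eps)); last by rewrite lerDr pr_ge0.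
  by have := c2; have := shift_le i; rewrite -/eps; lra.
have e0 : 0 < e by have := shift_ge0 iN; rewrite -/eps; lra.
have d : dominated e nu (phi mu).
  apply: levy_prokhorov_dominated; apply: le_lt_trans epse.
  rewrite -(same_measure_levy_prokhorov _ nuF) phi_iso.
  by apply: levy_prokhorov_le_of_lt => //; exact: shift_ge0.
have mU : measurable ([set x 0%N] `|` [set x i + v] : set (borel_space X)).
  by apply: measurableU; exact: set1_borel.
have := d _ mU; rewrite pr_setU; [|exact: set1_borel|exact: set1_borel|]; last first.
  apply/seteqP; split => // z [-> /= e1].
  have := far_base far iN; rewrite e1 opprD addrA subrr add0r normrN.
  by have := c2; have := shift_le i; rewrite -/eps; lra.
rewrite nu0 nui.
suff : pr (phi mu) (thickening ([set x 0%N] `|` [set x i + v]) e) <=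
    w 0%N + pr (phi mu) (ball (x i + v) e) by lra.
rewrite -m0; apply: le_trans (pr_setU_le _ (set1_borel _) (ball_borel _ _)).
apply: (le_pr_supp X_sep); first exact: thickening_borel.
  by apply: measurableU; [exact: set1_borel|exact: ball_borel].
move=> z sz [_ [->|->]]; last by right.
by rewrite in_ball => zx; left; apply: iso' => //; lra.
Qed.

(** If [z] is none of the [x k], each [x k] with [k > 0] is translated directly away from [z]. The
    balls of [pushed_atom], with [x 0], then carry all of [phi mu], but none contains [z]. *)
Lemma supp_image z : supp (phi mu) z -> exists2 k, (k <= n)%N & z = x k.
Proof.
move=> sz; apply: contrapT => nz.
have zx k : (k <= n)%N -> 0 < `|z - x k|.
  move=> kN; rewrite normr_gt0 subr_eq0; apply/eqP => e; apply: nz.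
  by exists k.
case: base_atom => _ [_ m0]; case: (sp) => s1 sep far.
pose v k := - (shift mu x k / `|z - x k|) *: (z - x k).
have nv k : (0 < k <= n)%N -> `|v k| = shift mu x k.
  move=> kN; have := zx k; case/andP: (kN) => _ -> /(_ isT) zk.
  rewrite /v normrZ normrN ger0_norm ?divr_ge0 ?shift_ge0//.
  by rewrite divfK// gt_eqF.
pose D k := if k == 0%N then [set x 0%N] else cball (x k + v k) (shift mu x k).
have Dk k : (0 < k)%N -> D k = cball (x k + v k) (shift mu x k).
  by move=> k0; rewrite /D gtn_eqF.
(* Translation and radius are at most [c] each; the separation [4 * c] in [spread] is twice this
   sum. *)
have sD k u : (0 < k <= n)%N -> D k u -> `|u - x k| <= 2 * c.
  move=> kN; case/andP: (kN) => k0 _; rewrite Dk// /cball /= opprD addrA => h.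
  have := ler_normD (u - x k - v k) (v k); rewrite subrK nv//.
  by have := shift_le k; lra.
have cD k : closed (D k).
  rewrite /D; case: ifP => _; last exact: closed_cball.
  exact: closed_point.
pose B := \bigcup_(k < n.+1) D k.
have cB : closed B by rewrite /B bigcup_mkord; apply: closed_bigsetU => k _.
suff /(supp_sub_closed cB) : 1 <= pr (phi mu) B.
  move=> /(_ _ sz)[k /=]; rewrite ltnS => kN.
  have [->|k0] := posnP k; first by move=> zx0; apply: nz; exists 0%N.
  rewrite Dk// /cball /= opprD addrA /v scaleNr opprK -{1}[z - x k]scale1r -scalerDl.
  have sk : 0 <= shift mu x k by apply: shift_ge0; rewrite k0.
  have zk := zx k kN.
  rewrite normrZ ger0_norm ?addr_ge0 ?divr_ge0// mulrDl mul1r divfK ?gt_eqF//.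
  lra.
rewrite -s1 (eq_bigl (fun k : 'I_n.+1 => true))//.
apply: (@sum_le_pr _ (borel_space X) _ _ n.+1 D w predT).
- by move=> k _; apply: closed_borel.
- exact: closed_borel.
- move=> k l; rewrite !ltnS => kN lN kl.
  apply/seteqP; split => // u.
  wlog kl' : k l kN lN kl / (k < l)%N.
    move=> h [Du Du']; move: (kl); rewrite neq_ltn => /orP[|] lij.
      exact: (h k l).
    by apply: (h l k) => //; rewrite eq_sym.
  move=> [Du Du'].
  have l0N : (0 < l <= n)%N by rewrite lN (leq_ltn_trans _ kl').
  have ul := sD l u l0N Du'.
  have [k00|k0] := posnP k.
    move: Du; rewrite k00 /D eqxx => /= ux.
    by have := c2; have := far_base far l0N; move: ul; rewrite ux distrC; lra.
  have k0N : (0 < k <= n)%N by rewrite k0.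
  have uk := sD k u k0N Du; have := sep k l k0N l0N kl.
  by have := ler_distD u (x k) (x l); rewrite (distrC (x k) u); lra.
- move=> k; rewrite ltnS => kN; have [->|k0] := posnP k.
    by rewrite /D eqxx m0.
  have k0N : (0 < k <= n)%N by rewrite k0.
  by rewrite Dk//; apply: pushed_atom => //; rewrite nv.
- by move=> k kn _ u Du; exists k.
Qed.

(** For [v = 0] the ball around [x k] has mass at least [w k], and by separation [x k] is the only
    point of the list in it. *)
Lemma spread_step : same_measure (phi mu) mu.
Proof.
case: (sp) => s1 sep far; case: base_atom => _ [_ m0].
apply: (same_measure_atoms dx s1) => k; rewrite ltnS => kN.
have [->|k0] := posnP k; first by rewrite m0.
have k0N : (0 < k <= n)%N by rewrite k0.
have := @pushed_atom k 0 k0N; rewrite normr0 addr0 shift_ge0// => /(_ isT) h.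
apply: (le_trans h); apply: (le_pr_supp X_sep); [exact: cball_borel|exact: set1_borel|].
move=> z /supp_image[l lN ->]; rewrite /cball /= => xlk.
have [->//|lk] := eqVneq l k.
have sc := shift_le k; exfalso.
have [l0|l0] := posnP l.
  by move: xlk; have := c2; have := far_base far k0N; rewrite l0 distrC; lra.
have l0N : (0 < l <= n)%N by rewrite l0.
by have := c0; have := sep l k l0N k0N lk; lra.
Qed.

End Step.
End Rigidity.

(** * Density of finitely supported measures with a far point *)

Section Density.
Context {R : realType} {X : completeNormedModType R}.
Hypothesis X_sep : separable X.
Implicit Types (mu nu : borel_probability X).

(** The balls of radius [e] around a dense sequence cover the space, so finitely many of them miss
    mass less than [e]. *)
Lemma finite_approx mu (e : R) : 0 < e -> exists2 s : seq X, uniq s &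
  1 - e <= pr mu (\bigcup_(k < size s) ball (nth 0 s k) e).
Proof.
move=> e0; have [u hu] := separable_dense_seq X_sep.
pose F n := ~` \bigcup_(k < n) ball (u k) e.
have mU n : measurable (\bigcup_(k < n) ball (u k) e : set (borel_space X)).
  by apply: open_borel; apply: bigcup_open => k _; exact: ball_open.
have mF n : measurable (F n : set (borel_space X)) by exact: measurableC.
have [n hn] : exists n, pr mu (F n) < e.
  apply: contrapT => /forallNP h.
  suff : e <= pr mu (\bigcap_n F n).
    rewrite (_ : \bigcap_n F n = set0) ?pr_set0; first lra.
    apply/seteqP; split => // x hx; have [k xk] := hu x e e0.
    by apply: (hx k.+1 I); exists k => //=; rewrite in_ball.
  apply: (@pr_bigcap_ge _ (borel_space X)) => // [m n mn|n].
    apply: subsetC => x [k /= km xk]; exists k => //=; exact: leq_trans mn.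
  have /negP := h n; rewrite -leNgt => hn; apply: (le_trans hn).
  by rewrite lerDl invr_ge0.
exists (undup (mkseq u n)); first exact: undup_uniq.
have := pr_setC mu (mU n); rewrite -/(F n) => hF.
apply: (@le_trans _ _ (pr mu (\bigcup_(k < n) ball (u k) e))); first lra.
apply: le_pr => //.
  by apply: open_borel; apply: bigcup_open => k _; exact: ball_open.
move=> x [k /= kn xk].
have us : u k \in undup (mkseq u n).
  by rewrite mem_undup; apply/mapP; exists k => //; rewrite mem_iota.
exists (index (u k) (undup (mkseq u n))); first by rewrite /= index_mem.
by rewrite nth_index.
Qed.

Lemma exists_far (s : seq X) (u : X) : `|u| = 1 ->
  exists y, forall x, x \in s -> 3 <= `|x - y|.
Proof.
move=> u1; exists ((3 + \sum_(x <- s) `|x|) *: u) => x xs.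
have S0 : 0 <= \sum_(x <- s) `|x| by apply: sumr_ge0.
have : `|x| <= \sum_(x <- s) `|x|.
  by rewrite (big_rem x)//= lerDl sumr_ge0.
set S := \sum_(x <- s) _ in S0 *.
have : `|(3 + S) *: u| = 3 + S by rewrite normrZ u1 mulr1 ger0_norm//; lra.
set y := _ *: u; have := ler_distD x y 0; rewrite !subr0 (distrC y x); lra.
Qed.

(** The balls of [finite_approx] are cut into disjoint cells, and the mass of each cell is moved to
    its centre, by less than [e]. The remaining mass, at most [e] and possibly 0, goes to a far
    point, which becomes [x 0]. *)
Lemma finitely_supported_dense mu (u : X) (e : R) : `|u| = 1 -> 0 < e ->
  exists n (x : nat -> X) nu,
    [/\ distinct n.+1 x, \sum_(k < n.+1) pr nu [set x k] = 1,
      forall k, (0 < k <= n)%N -> 3 <= `|x k - x 0%N| & dominated e mu nu].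
Proof.
move=> u1 e0; have [s us hs] := finite_approx mu e0.
have [y hy] := exists_far s u1.
pose x k := if k is j.+1 then nth 0 s j else y.
have far k : (0 < k <= size s)%N -> 3 <= `|x k - x 0%N|.
  by case: k => // k /= ks; apply: hy; exact: mem_nth.
have dx : distinct (size s).+1 x.
  move=> i j; rewrite !ltnS => iN jN.
  wlog ij' : i j iN jN / (i < j)%N.
    move=> h ij xij; move: (ij); rewrite neq_ltn => /orP[|] lij; first exact: (h i j).
    by apply: (h j i) => //; rewrite eq_sym.
  case: i iN ij' => [|i] iN ij' ij e'.
    have := far j; rewrite jN ij' -e' subrr normr0 => /(_ isT); lra.
  case: j jN ij' ij e' => // j jN _ ij /eqP; rewrite nth_uniq//.
  by rewrite -eqSS (negbTE ij).
pose E : nat -> set X := seqDU (fun k => ball (nth 0 s k) e).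
have mE k : measurable (E k : set (borel_space X)).
  apply: (@measurableD _ (borel_space X)); first exact: ball_borel.
  by apply: (@bigsetU_measurable _ (borel_space X)) => i _; exact: ball_borel.
have tE : trivIset setT E by exact: trivIset_seqDU.
pose U := \bigcup_(k < size s) ball (nth 0 s k) e.
have mU : measurable (U : set (borel_space X)).
  by apply: open_borel; apply: bigcup_open => k _; exact: ball_open.
have UE : U = \bigcup_(k < size s) E k.
  by rewrite /U !bigcup_mkord; exact: bigsetU_seqDU.
have prA A : measurable (A : set (borel_space X)) ->
    pr mu (A `&` U) = \sum_(k < size s) pr mu (A `&` E k).
  move=> mA; apply: EFin_inj; rewrite -sumEFin -prE; last exact: measurableI.
  rewrite UE setI_bigcupr bigcup_mkord.
  have mAE k : measurable (A `&` E k : set (borel_space X)) by exact: measurableI.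
  rewrite (@measure_bigsetU _ R (borel_space X) mu (fun k => A `&` E k) mAE).
    by apply: eq_bigr => k _; exact: prE.
  exact: trivIset_setIl.
pose w k : R := if k is j.+1 then pr mu (E j) else 1 - pr mu U.
have w0 k : 0 <= w k.
  by case: k => [|k] /=; [rewrite subr_ge0 pr_le1|exact: pr_ge0].
have w1 : \sum_(k < (size s).+1) w k = 1.
  have prU : pr mu U = \sum_(k < size s) pr mu (E k).
    by rewrite -[U]setTI prA//; apply: eq_bigr => k _; rewrite setTI.
  by rewrite big_ord_recl /= prU; lra.
have [nu nuE] := exists_atomic dx w0 w1.
exists (size s), x, nu; split => //.
  by rewrite -w1; apply: eq_bigr => k _; rewrite nuE.
move=> A mA; have mUC := measurableC mU.
have : pr mu A <= pr mu (A `&` U) + pr mu (~` U).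
  apply: le_trans (pr_setU_le _ (measurableI _ _ mA mU) mUC).
  apply: le_pr => //; first by apply: measurableU => //; exact: measurableI.
  by move=> z Az; have [Uz|] := pselect (U z); [left|right].
rewrite pr_setC// prA// => h.
suff : \sum_(k < size s) pr mu (A `&` E k) <= pr nu (thickening A e) by move: hs; rewrite -/U; lra.
apply: le_trans (sum_atoms_le nu dx (thickening_borel A e)).
rewrite [leRHS]big_mkcond big_ord_recl/=; apply: ler_wpDl.
  by case: ifP => // _; exact: pr_ge0.
apply: ler_sum => k _; case: ifPn => [_|].
  rewrite -[X in pr nu X]/[set x k.+1] nuE ?ltnS//=.
  apply: le_pr => //; exact: measurableI.
rewrite notin_setE => h'; rewrite (_ : A `&` E k = set0) ?pr_set0//.
apply/seteqP; split => // z [Az [kz _]]; apply: h'; exists z => //.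
exact: ball_sym.
Qed.

End Density.

(** * From finitely supported measures to all measures *)

Section FixingDiracs.
Context {R : realType} {X : completeNormedModType R}.
Hypothesis X_sep : separable X.
Implicit Types (mu nu : borel_probability X).
Variable phi : borel_probability X -> borel_probability X.
Hypothesis phi_iso : forall mu nu,
  levy_prokhorov (phi mu) (phi nu) = levy_prokhorov mu nu.
Hypothesis phi_delta : forall x, same_measure (phi (delta x)) (delta x).

Lemma fixed_of_supp_point mu z : supp mu `<=` [set z] -> same_measure (phi mu) mu.
Proof.
move=> /(same_measure_delta X_sep) h.
apply: same_measure_trans (isometry_same phi_iso h) _.
by apply: same_measure_trans (phi_delta z) _; exact: same_measure_sym.
Qed.

Lemma spread_fixed (c : R) K : 0 < c -> c < 2^-1 ->
  forall n (x : nat -> X) mu, spread c n x mu ->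
  1 - pr mu [set x 0%N] <= K%:R * c -> same_measure (phi mu) mu.
Proof.
move=> c0 c2; elim: K => [|K IH] n x mu sp Kc.
  apply: (@fixed_of_supp_point _ (x 0%N)); apply: supp_sub_closed; last lra.
  exact: closed_point.
exact: (spread_step X_sep phi_iso phi_delta c0 c2 IH sp Kc).
Qed.

Lemma finitely_supported_fixed n (x : nat -> X) mu : distinct n.+1 x ->
  \sum_(k < n.+1) pr mu [set x k] = 1 ->
  (forall k, (0 < k <= n)%N -> 3 <= `|x k - x 0%N|) -> same_measure (phi mu) mu.
Proof.
move=> dx s1 far; have [d d0 dsep] := finite_separation dx.
(* Dividing by 5 gives both [4 * c < d] and [c < 1/2]. *)
pose c := Num.min d 1 / 5.
have [c0 [cd c1]] : 0 < c /\ 4 * c < d /\ c < 2^-1.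
  have : 0 < Num.min d 1 by rewrite lt_min d0 ltr01.
  have : Num.min d 1 <= d by rewrite ge_min lexx.
  have : Num.min d 1 <= 1 by rewrite ge_min lexx orbT.
  rewrite /c; lra.
(* [K] steps of size [c] exhaust the total mass, so a base atom of mass 0 is covered. *)
have [K Kc] : exists K : nat, 1 <= K%:R * c.
  exists (Num.bound c^-1); rewrite -ler_pdivrMr// mul1r ltW//.
  by apply: archi_boundP; rewrite invr_ge0 ltW.
apply: (@spread_fixed c K c0 c1 n x); last first.
  by have := pr_ge0 mu [set x 0%N]; lra.
split => // [i j /andP[_ iN] /andP[_ jN] ij|k /far]; last first.
  by have := pr_ge0 mu [set x 0%N]; lra.
by have := dsep i j iN jN ij; lra.
Qed.

(** A fixed measure within [e / 2] of [mu] is also within [e / 2] of [phi mu]. *)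
Theorem isometry_fixing_diracs mu : same_measure (phi mu) mu.
Proof.
(* The zero space has no far points; there every measure is the Dirac mass at 0. *)
have [[v v0]|h] := pselect (exists v : X, v != 0); last first.
  have hz (z : X) : z = 0.
    by apply/eqP; apply: contrapT => /negP z0; apply: h; exists z.
  by apply: (@fixed_of_supp_point _ 0) => z _; exact: hz.
pose u := `|v|^-1 *: v.
have u1 : `|u| = 1 by rewrite normrZ normfV normr_id mulVf// normr_eq0.
apply: levy_prokhorov_eq0; apply/eqP; rewrite eq_le levy_prokhorov_ge0 andbT.
apply/ler_addgt0Pr => e e0; rewrite add0r.
have e20 : 0 < e / 2 by lra.
have [n [x [nu [dx s1 far dom]]]] := finitely_supported_dense X_sep mu u1 e20.
have nuF := finitely_supported_fixed dx s1 far.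
have d := levy_prokhorov_le e20 dom.
have := levy_prokhorov_triangle (phi mu) nu mu.
rewrite [levy_prokhorov nu mu]levy_prokhorov_sym.
rewrite [levy_prokhorov (phi mu) nu]levy_prokhorov_sym.
rewrite -(same_measure_levy_prokhorov _ nuF) phi_iso.
rewrite [levy_prokhorov nu mu]levy_prokhorov_sym; lra.
Qed.

End FixingDiracs.

(** * The map induced on points *)

Section InducedMap.
Context {R : realType} {X : completeNormedModType R}.
Hypothesis X_sep : separable X.
Implicit Types (mu nu : borel_probability X) (x y z : X).

(** If [z] and [x] differ, a point violating the inclusion is given by [exists_on_sphere] when they
    are closer than 2, and by [z] itself otherwise. *)
Lemma unit_ball_sub_center x z : (forall p, `|z - p| < 1 -> `|x - p| < 1) -> z = x.
Proof.
move=> h; apply/eqP; apply: contrapT => /negP zx.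
have [zx2|zx2] := ltP `|z - x| 2.
  have [p pz px] := exists_on_sphere zx zx2.
  by have := h p; rewrite distrC pz distrC px ltxx => /(_ isT).
have := h z; rewrite subrr normr0 ltr01 => /(_ isT); rewrite distrC; lra.
Qed.

Variable phi : borel_probability X -> borel_probability X.
Hypothesis phi_surj : forall nu, exists mu, same_measure (phi mu) nu.
Hypothesis phi_iso : forall mu nu,
  levy_prokhorov (phi mu) (phi nu) = levy_prokhorov mu nu.

Lemma levy_prokhorov_delta_lt1 z nu : levy_prokhorov (delta z) nu < 1 <->
  exists2 y, supp nu y & `|z - y| < 1.
Proof.
split=> [/(levy_prokhorov_lt1 X_sep)[x [y []]]|[y sy zy]].
  by rewrite supp_delta => -> sy xy; exists y.
by apply/(levy_prokhorov_lt1 X_sep); exists z, y; rewrite supp_delta.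
Qed.

(** Let [z] be in the support of [phi (delta x)] and [phi k = delta z]. If [delta p] is closer than
    1 to [k], then [phi (delta p)] has a support point within 1 of [z], whence [|x - p| < 1]. By
    [unit_ball_sub_center], [supp k] reduces to [x]. *)
Lemma diracs_to_diracs x : exists z, same_measure (phi (delta x)) (delta z).
Proof.
have [z sz] := supp_nonempty X_sep (phi (delta x)); exists z.
have [k hk] := phi_surj (delta z).
have near_k p : levy_prokhorov k (delta p) < 1 -> `|x - p| < 1.
  rewrite -phi_iso (same_measure_levy_prokhorov _ hk).
  move=> /levy_prokhorov_delta_lt1[y sy zy].
  have : levy_prokhorov (phi (delta x)) (phi (delta p)) < 1.
    by apply/(levy_prokhorov_lt1 X_sep); exists z, y.
  rewrite phi_iso => /levy_prokhorov_delta_lt1[q]; rewrite supp_delta => -> //.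
have sk : supp k `<=` [set x].
  move=> y sy; apply: unit_ball_sub_center => p yp; apply: near_k.
  by apply/(levy_prokhorov_lt1 X_sep); exists y, p; rewrite supp_delta.
have := isometry_same phi_iso (same_measure_delta X_sep sk) => h.
by apply: same_measure_trans (same_measure_sym h) hk.
Qed.

Variable psi : X -> X.
Hypothesis psiE : forall x, same_measure (phi (delta x)) (delta (psi x)).

Lemma levy_prokhorov_induced x y :
  levy_prokhorov (delta (psi x)) (delta (psi y)) = levy_prokhorov (delta x) (delta y).
Proof.
rewrite -(same_measure_levy_prokhorov _ (psiE x)) levy_prokhorov_sym.
by rewrite -(same_measure_levy_prokhorov _ (psiE y)) phi_iso levy_prokhorov_sym.
Qed.

(** For [x] in the support of a preimage of [delta y], the same detection argument puts the unit
    ball around [psi x] inside the one around [y]. *)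
Lemma induced_surjective y : exists x, psi x = y.
Proof.
have [k hk] := phi_surj (delta y).
have [x sx] := supp_nonempty X_sep k; exists x.
apply: unit_ball_sub_center => p xp; have [q hq] := phi_surj (delta p).
have : levy_prokhorov (delta x) q < 1.
  rewrite -phi_iso (same_measure_levy_prokhorov _ (psiE x)).
  by rewrite levy_prokhorov_sym (same_measure_levy_prokhorov _ hq)
    levy_prokhorov_delta gt_min ltxx distrC.
move=> /levy_prokhorov_delta_lt1[u su xu].
have : levy_prokhorov k q < 1.
  by apply/(levy_prokhorov_lt1 X_sep); exists x, u.
rewrite -phi_iso (same_measure_levy_prokhorov _ hk) levy_prokhorov_sym.
rewrite (same_measure_levy_prokhorov _ hq) levy_prokhorov_delta gt_min ltxx distrC.
exact.
Qed.

End InducedMap.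

(** * Push-forward of measures by a bijective isometry *)

Section Pushforward.
Context {R : realType} {X : completeNormedModType R}.

Lemma continuous_borel (f : borel_space X -> borel_space X) :
  continuous (f : X -> X) -> measurable_fun setT f.
Proof.
move=> cf.
apply: (@measurability _ _ (borel_space X) (borel_space X) setT f (@open X)) => //.
move=> _ [A oA <-]; rewrite setTI; apply: open_borel.
by move/continuousP : cf; exact.
Qed.

Lemma preimage_borel (f : X -> X) (A : set (borel_space X)) : continuous f ->
  measurable A -> measurable (f @^-1` A : set (borel_space X)).
Proof.
by move=> cf mA; rewrite -[X in measurable X]setTI; exact: continuous_borel.
Qed.

Lemma exists_pushforward (f : X -> X) : continuous f ->
  exists push : borel_probability X -> borel_probability X,
    forall mu (A : set (borel_space X)), measurable A ->
      push mu A = mu (f @^-1` A).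
Proof.
move=> /continuous_borel mf.
pose F : {mfun (borel_space X) >-> (borel_space X)} := mfun_Sub (mem_set mf).
by exists (fun mu => distribution mu F).
Qed.

(** Preimages under a bijective isometry commute with thickenings, and every Borel set is the
    preimage of a Borel set. *)
Lemma pushforward_isometry (f f' : X -> X)
    (push : borel_probability X -> borel_probability X) :
  isometric f -> cancel f f' -> cancel f' f ->
  (forall mu (A : set (borel_space X)), measurable A ->
      push mu A = mu (f @^-1` A)) ->
  forall mu nu, levy_prokhorov (push mu) (push nu) = levy_prokhorov mu nu.
Proof.
move=> hf fK f'K pushE mu nu.
have hf' := isometric_cancel hf f'K.
have cf := isometric_continuous hf; have cf' := isometric_continuous hf'.
have prpush rho A : measurable (A : set (borel_space X)) ->
    pr (push rho) A = pr rho (f @^-1` A) by move=> mA; rewrite /pr pushE.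
have thick A e : f @^-1` (thickening A e) = thickening (f @^-1` A) e.
  apply/seteqP; split => [z [x Ax]|z [x Ax]]; rewrite in_ball => xz.
    exists (f' x); first by rewrite /= f'K.
    by rewrite in_ball -hf f'K.
  by exists (f x) => //; rewrite in_ball hf.
have dom e : dominated e (push mu) (push nu) <-> dominated e mu nu.
  split=> h A mA; last first.
    rewrite !prpush//; last exact: thickening_borel.
    by rewrite thick; apply: h; exact: preimage_borel.
  have := h _ (preimage_borel cf' mA); rewrite !prpush ?thick.
  - rewrite (_ : f @^-1` (f' @^-1` A) = A)//.
    by apply/seteqP; split => z /=; rewrite fK.
  - exact: thickening_borel.
  - exact: preimage_borel.
rewrite /levy_prokhorov; congr inf; apply/seteqP.
by split=> e [e0 /dominatedP/dom/dominatedP].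
Qed.

End Pushforward.

Theorem mainTheorem1 (R : realType) (X : completeNormedModType R)
    (X_separable : separable X)
    (phi : borel_probability X -> borel_probability X)
    (phi_isometry : surjective_lp_isometry phi) :
  exists psi : X -> X,
    [/\ (forall y, exists x, psi x = y),
        affine_map psi,
        norm_isometry psi &
        forall (mu : borel_probability X) (A : set (borel_space X)),
          measurable A -> phi mu A = mu (psi @^-1` A)].
Proof.
case: phi_isometry => phi_surj phi_iso.
have [psi psiE] := choice (diracs_to_diracs X_separable phi_surj phi_iso).
have surj := induced_surjective X_separable phi_surj phi_iso psiE.
have [psi' psi'K] := choice surj.
have tpsi x y : Num.min 1 `|psi x - psi y| = Num.min 1 `|x - y|.
  by rewrite -!levy_prokhorov_delta; exact: levy_prokhorov_induced psiE x y.
have tpsi' x y : Num.min 1 `|psi' x - psi' y| = Num.min 1 `|x - y|.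
  by rewrite -tpsi !psi'K.
(* Both [psi] and its inverse preserve truncated distances, so neither increases distances. *)
have hpsi : isometric psi.
  move=> x y; apply/eqP; rewrite eq_le truncated_isometry_le//=.
  have psiK z : psi' (psi z) = z.
    apply/eqP; rewrite -subr_eq0 -normr_eq0; apply/eqP.
    have := tpsi (psi' (psi z)) z; rewrite psi'K subrr normr0 (min_r ler01).
    by rewrite minElt; case: ifP => // _ /eqP; rewrite eq_sym oner_eq0.
  by rewrite -{1}(psiK x) -{1}(psiK y) truncated_isometry_le.
have psiK : cancel psi psi' by move=> x; apply: (isometric_inj hpsi); rewrite psi'K.
have hpsi' : isometric psi' := isometric_cancel hpsi psi'K.
have cpsi := isometric_continuous hpsi.
exists psi; split => //; first exact: mazur_ulam hpsi psiK psi'K.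
have [push pushE] := exists_pushforward (isometric_continuous hpsi').
have push_iso := pushforward_isometry hpsi' psi'K psiK pushE.
(* Pushing forward by [psi'] undoes [psi] on Dirac masses, so the composite fixes them and hence
   every measure. Evaluating it at [psi @^-1] of [A] gives the formula. *)
have fixed := @isometry_fixing_diracs _ _ X_separable (push \o phi).
move=> mu A mA; have mB := preimage_borel cpsi mA.
rewrite -(fixed _ _ mu _ mB)/= ?pushE//.
- by congr (phi mu _); apply/seteqP; split => z /=; rewrite psi'K.
- by move=> nu rho; rewrite /= push_iso phi_iso.
- move=> x; apply: same_measure_trans (isometry_same push_iso (psiE x)) _.
  move=> B mB'; rewrite pushE// /delta /= /dirac !indicE; congr ((nat_of_bool _)%:R%:E).
  by apply/idP/idP; rewrite !inE /= psiK.
Qed.
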